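(* There exists a randomized algorithm in the Massive Parallel Computation (MPC) model that, given an $n$-vertex graph $G$, with high probability computes an $O(\log n)$-approximation to the minimum vertex cover of $G$ in $O(\log\log n)$ rounds, when the memory per machine is $O(n)$.
   Context: A vertex cover of a graph $G=(V,E)$ is a set $C\subseteq V$ such that every edge has at least one endpoint in $C$; an $\alpha$-approximation is a vertex cover of size at most $\alpha$ times the minimum vertex cover size. MPC model: there are $p$ machines, each with memory $s$, with $p\cdot s=O(N)$ where $N$ is the total memory needed to represent the input (here the graph's edges are distributed among the machines). Computation proceeds in synchronous rounds; in each round every machine performs local computation and then machines exchange messages, and the total size of messages sent and received by a machine in a round must be at most $s$. At the end the machines collectively output the solution, and each machine's output must fit in its memory. ''With high probability'' means with probability $1-1/\mathrm{poly}(n)$. *)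

(* Defs.v *)
From mathcomp Require Import all_boot all_order all_algebra.

Set Implicit Arguments.
Unset Strict Implicit.
Unset Printing Implicit Defensive.

Section Graph.

Variables (n : nat) (e : rel 'I_n).

Definition simple_graph : Prop := symmetric e /\ irreflexive e.

(* Each undirected edge {u, v} is represented once, by the pair with u < v. *)
Definition edges : {set 'I_n * 'I_n} :=
  [set uv : 'I_n * 'I_n | (uv.1 < uv.2) && e uv.1 uv.2].

Definition vertex_cover (C : {set 'I_n}) : bool :=
  [forall u, forall v, e u v ==> (u \in C) || (v \in C)].

Definition min_vertex_cover_size : nat :=
  #|[arg min_(C < setT | vertex_cover C) #|C|]|.

Definition approx_vertex_cover (alpha : nat) (C : {set 'I_n}) : bool :=
  vertex_cover C && (#|C| <= alpha * min_vertex_cover_size).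

End Graph.

(* Memory contents and messages are sequences of machine words, a word being a
   natural number below a bound W fixed by [mpc_legal] below; sizes are counted
   in words.  In every round each machine draws a fresh uniform element of
   [mpc_coins], independently of the other machines and rounds.  Coins are not
   readable in later rounds, except for what the machine stores in its memory.

   [mpc_step r i x mem inbox] is the local computation of machine i in round r
   with coins x: it returns the memory that i retains and the message that i
   sends to each machine ([::] for no message).  Local computation is an
   arbitrary function.  [mpc_output] is the local computation following the
   last round. *)
Record mpc_algorithm (n : nat) := MPCAlgorithm {
  mpc_machines : nat;
  mpc_memory : nat;
  mpc_rounds : nat;
  mpc_coins : finType;
  mpc_coins_inhabited : 0 < #|mpc_coins|;
  mpc_step : nat -> 'I_mpc_machines -> mpc_coins ->
    seq nat -> ('I_mpc_machines -> seq nat) ->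
    seq nat * ('I_mpc_machines -> seq nat);
  mpc_output : 'I_mpc_machines ->
    seq nat -> ('I_mpc_machines -> seq nat) -> {set 'I_n}
}.

Section Execution.

Variables (n : nat) (A : mpc_algorithm n).

Local Notation p := (mpc_machines A).
Local Notation s := (mpc_memory A).

(* For every machine, its memory and the messages it received, by sender. *)
Definition mpc_config : Type := 'I_p -> seq nat * ('I_p -> seq nat).

Definition mpc_input : Type := 'I_p -> seq ('I_n * 'I_n).

(* Every edge is on exactly one machine, in an arbitrary order, and the edges of
   a machine, two words each, fit in its memory. *)
Definition distributes (e : rel 'I_n) (inp : mpc_input) : Prop :=
  perm_eq (flatten [seq inp i | i : 'I_p]) (enum (edges e)) /\
  forall i, 2 * size (inp i) <= s.

Definition mpc_init (inp : mpc_input) : mpc_config :=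
  fun i => (flatten [seq [:: val uv.1; val uv.2] | uv <- inp i], fun=> [::]).

Definition round_coins : finType := {ffun 'I_p -> mpc_coins A}.

Definition act (r : nat) (x : round_coins) (c : mpc_config) (i : 'I_p) :
    seq nat * ('I_p -> seq nat) :=
  mpc_step r i (x i) (c i).1 (c i).2.

Definition next_config (r : nat) (x : round_coins) (c : mpc_config) :
    mpc_config :=
  fun i => ((act r x c i).1, fun j => (act r x c j).2 i).

Definition sent (r : nat) (x : round_coins) (c : mpc_config) (i : 'I_p) : nat :=
  \sum_(j < p) size ((act r x c i).2 j).

Definition received (r : nat) (x : round_coins) (c : mpc_config) (i : 'I_p) :
    nat :=
  \sum_(j < p) size ((act r x c j).2 i).

Definition is_word (W : nat) : pred nat := fun a => a < W.

Definition legal_round (W r : nat) (x : round_coins) (c : mpc_config) : Prop :=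
  forall i : 'I_p,
    [/\ sent r x c i + received r x c i <= s,
        size (act r x c i).1 + received r x c i <= s,
        all (is_word W) (act r x c i).1
      & forall j : 'I_p, all (is_word W) ((act r x c i).2 j)].

(* Execution from round r on, with one entry of xs for each remaining round. *)
Fixpoint run_from (r : nat) (xs : seq round_coins) (c : mpc_config) :
    mpc_config :=
  if xs is x :: xs' then run_from r.+1 xs' (next_config r x c) else c.

Fixpoint legal_from (W r : nat) (xs : seq round_coins) (c : mpc_config) :
    Prop :=
  if xs is x :: xs' then
    legal_round W r x c /\ legal_from W r.+1 xs' (next_config r x c)
  else True.

Definition mpc_randomness : finType := (mpc_rounds A).-tuple round_coins.

Definition machine_output (inp : mpc_input) (w : mpc_randomness) (i : 'I_p) :
    {set 'I_n} :=
  let c := run_from 0 w (mpc_init inp) in mpc_output i (c i).1 (c i).2.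

Definition mpc_result (inp : mpc_input) (w : mpc_randomness) : {set 'I_n} :=
  \bigcup_(i < p) machine_output inp w i.

(* The limits on memory, communication and output hold for all coin outcomes,
   not only with high probability. *)
Definition mpc_legal (W : nat) (inp : mpc_input) : Prop :=
  forall w : mpc_randomness,
    legal_from W 0 w (mpc_init inp) /\
    forall i : 'I_p, #|machine_output inp w i| <= s.

Definition mpc_prob (inp : mpc_input) (P : pred {set 'I_n}) : rat :=
  (#|[set w : mpc_randomness | P (mpc_result inp w)]|%:R
   / #|mpc_randomness|%:R)%R.

End Execution.

(* The floor of the base 2 logarithm, which is within a constant factor of any
   other logarithm of n once n >= 2; its iterate is positive once n >= 4. *)
Definition log (n : nat) : nat := trunc_log 2 n.

(* Main.v *)
Require Import Defs.
From mathcomp Require Import all_boot all_order all_algebra.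
From mathcomp Require Import zify.

(* Parnas-Ron peeling removes, for falling thresholds, all vertices of high
   residual degree.  A whole range of thresholds is compressed into one phase:
   vertices are coloured at random with k = 2 ^ kappa colours and each colour
   class is peeled on one machine, with thresholds scaled by 1 / k.

   Fix a minimum cover O.  Compare the sampled peelings with an idealised one
   that knows O and does not depend on the colouring.  It removes a vertex of O
   if it has many surviving neighbours outside O, and a vertex outside O if it
   has, by a constant factor, fewer surviving neighbours in O.  As all edges
   meet O, Chernoff bounds for these fixed neighbourhoods give by induction that
   within O a class removes at least the vertices that the ideal peeling
   removes, and outside O at most those.  The ideal peeling removes O(|O|)
   vertices outside O for each halving of the degree.  After a phase, vertices
   whose exact residual degree is still large are therefore in O or already
   paid for, and are removed as well.

   A phase with k about sqrt Delta brings the maximum degree from Delta down to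
   sqrt Delta * polylog n, with classes of O(n) edges.  The first phase uses
   k about m / n, so that only O(n) edges are monochromatic; here the degrees
   may be irregular and Chebyshev's inequality is used instead.  After
   O(log log n) phases the degree is polylogarithmic, and exact removal alone
   halves it in each further phase. *)

Set Implicit Arguments.
Unset Strict Implicit.
Unset Printing Implicit Defensive.

(** * Random colourings *)

Lemma expn_mono (e a b : nat) : a <= b -> a ^ e <= b ^ e.
Proof. by case: e => // e ab; rewrite leq_exp2r. Qed.

(** Bernoulli's inequality (1 - 1/(k+1))^j >= 1 - j/(k+1), cleared of denominators. *)
Lemma expn_ratio (k j : nat) : j <= k.+1 ->
  k.+1 ^ j * (k.+1 - j) <= k ^ j * k.+1.
Proof.
elim: j => [|j IHj] lejk; first by rewrite !expn0 subn0.
have {IHj} := IHj (ltnW lejk).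
rewrite !expnS; set a := _ ^ j; set b := k ^ j => IHj.
have : k * (a * (k.+1 - j)) <= k * (b * k.+1) by rewrite leq_mul2l IHj orbT.
have -> : k.+1 - j = (k.+1 - j.+1).+1 by lia.
have : k.+1 - j.+1 <= k by lia.
nia.
Qed.

(** This is (1 + 1/k)^k <= 4: the exponent is split into two halves, and by [expn_ratio] each
    contributes a factor of at most 2. *)
Lemma expnS_le4 (k : nat) : 0 < k -> k.+1 ^ k <= 4 * k ^ k.
Proof.
move=> k0; have half j : j.*2 <= k.+1 -> k.+1 ^ j <= 2 * k ^ j.
  move=> jk; have /expn_ratio : j <= k.+1 by lia.
  by set a := _ ^ j; set b := k ^ j; nia.
have /half h1 : k./2.*2 <= k.+1 by lia.
have /half h2 : (uphalf k).*2 <= k.+1 by lia.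
have -> : 4 * k ^ k = (2 * k ^ k./2) * (2 * k ^ uphalf k).
  have {2}-> : k = k./2 + uphalf k by lia.
  by rewrite expnD; lia.
have {2}-> : k = k./2 + uphalf k by lia.
by rewrite expnD leq_mul.
Qed.

(** The first two terms of the binomial expansion of the right side suffice. *)
Lemma expn_double_pred (j : nat) : 2 * j ^ j.+1 <= j.+1 ^ j.+1.
Proof.
have bern i : j ^ i.+1 + i.+1 * j ^ i <= j.+1 ^ i.+1.
  elim: i => [|i]; first by rewrite !expn1 !expn0; lia.
  by rewrite !(expnS j.+1) !(expnS j); set a := j ^ i; set b := j.+1 ^ i; nia.
have := bern j; rewrite !expnS; set a := j ^ j; set b := j.+1 ^ j; nia.
Qed.

Section Colourings.

Variables (T : finType) (k : nat).
Implicit Types (N : {set T}) (c : nat) (chi : {ffun T -> 'I_k}).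

Definition hits chi c N : nat := #|[set u in N | chi u == c :> nat]|.

(** Colours are independent, so this generating function of [hits] is a product over the elements.
    It gives the exponential moments for both Chernoff bounds. *)
Lemma sum_weights (a b : nat) N c : c < k ->
  \sum_(chi : {ffun T -> 'I_k}) \prod_(u in N) (if chi u == c :> nat then a else b)
  = (a + k.-1 * b) ^ #|N| * k ^ (#|T| - #|N|).
Proof.
move=> ck.
pose F (u : T) (j : 'I_k) := if u \in N then (if j == c :> nat then a else b) else 1.
transitivity (\sum_(chi : {ffun T -> 'I_k}) \prod_u F u (chi u)).
  by apply: eq_bigr => chi _; rewrite big_mkcond.
rewrite -(bigA_distr_bigA F) (bigID (mem N)) /=; congr (_ * _).
  rewrite (eq_bigr (fun=> a + k.-1 * b)) ?prod_nat_const // => u uN.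
  rewrite /F uN (bigD1 (Ordinal ck)) //= eqxx; congr (_ + _).
  rewrite (eq_bigr (fun=> b)) => [|j /negbTE jc].
    by rewrite sum_nat_const cardC1 card_ord.
  by rewrite -val_eqE /= in jc; rewrite jc.
rewrite (eq_bigr (fun=> k)) => [|u /negbTE uN].
  by rewrite prod_nat_const -(cardC (mem N)) addKn.
rewrite /F uN sum1_card card_ord //.
Qed.

Lemma sum_weights_expn (a b : nat) N c chi :
  \prod_(u in N) (if chi u == c :> nat then a else b)
  = a ^ hits chi c N * b ^ (#|N| - hits chi c N).
Proof.
rewrite (bigID (fun u => chi u == c :> nat)) /=; congr (_ * _).
  rewrite (eq_bigr (fun=> a)) => [|u /andP[_ ->] //].
  by rewrite prod_nat_const /hits cardsE.
rewrite (eq_bigr (fun=> b)) => [|u /andP[_ /negbTE ->] //].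
rewrite prod_nat_const; congr (_ ^ _).
rewrite -(cardID (fun u => chi u == c :> nat) N) /hits cardsE /=.
rewrite [X in _ = X + _ - _](_ : _ = #|[pred u | (u \in N) && (chi u == c :> nat)]|).
  by rewrite addKn; apply: eq_card => u; rewrite !inE andbC.
by apply: eq_card => u; rewrite !inE andbC.
Qed.

Lemma markov_count (I : finType) (P : pred I) (f : I -> nat) (b : nat) :
  (forall i, P i -> b <= f i) -> #|[set i | P i]| * b <= \sum_i f i.
Proof.
move=> Pf; rewrite -sum_nat_const (bigID (mem [set i | P i]) predT) /=.
apply: leq_trans (leq_addr _ _); apply: leq_sum => i; rewrite inE; exact: Pf.
Qed.

(** Chernoff bound for a mean of at most [q]: Markov's inequality for 2^hits, whose mean (1 +
    1/k)^|N| is at most 4^q by [expnS_le4]. *)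
Lemma hits_upper_tail N c q : 0 < k -> c < k -> #|N| <= k * q ->
  #|[set chi : {ffun T -> 'I_k} | 4 * q <= hits chi c N]| * 2 ^ (2 * q)
  <= k ^ #|T|.
Proof.
move=> k0 ck leN; set B := [set _ | _].
have : #|B| * 2 ^ (4 * q) <= k.+1 ^ #|N| * k ^ (#|T| - #|N|).
  have <- : 2 + k.-1 * 1 = k.+1 by lia.
  rewrite -(sum_weights 2 1 N ck); apply: markov_count => chi hchi.
  by rewrite sum_weights_expn exp1n muln1 leq_exp2l.
move=> hB; have NT : #|N| <= #|T| by apply: max_card.
have hN : k.+1 ^ #|N| <= k ^ #|N| * 2 ^ (2 * q).
  have : k.+1 ^ (k * q) <= k ^ (k * q) * 2 ^ (2 * q).
    rewrite !expnM -expnMn; apply: expn_mono; rewrite mulnC; exact: expnS_le4.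
  have kN : 0 < k ^ (k * q - #|N|) by rewrite expn_gt0 k0.
  rewrite -{1 2}(subnKC leN) !expnD => h.
  rewrite -(leq_pmul2r kN).
  apply: leq_trans (_ : _ <= k.+1 ^ #|N| * k.+1 ^ (k * q - #|N|)) _.
    by rewrite leq_mul2l expn_mono ?orbT.
  by rewrite [X in _ <= X]mulnAC.
have q0 : 0 < 2 ^ (2 * q) by rewrite expn_gt0.
rewrite -(leq_pmul2r q0) -mulnA -expnD.
have -> : 2 * q + 2 * q = 4 * q by lia.
apply: leq_trans hB _; rewrite -[in X in _ <= X](subnKC NT) expnD.
by rewrite mulnAC leq_mul2r hN orbT.
Qed.

(** Here the mean is at least [16 * q]. Markov's inequality is applied to 2^(|N| - hits), of mean
    2^|N| (1 - 1/(2k))^|N|; by [expn_double_pred] the last factor is at most 2^(-8q). *)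
Lemma hits_lower_tail N c q : 0 < k -> c < k -> 16 * k * q <= #|N| ->
  #|[set chi : {ffun T -> 'I_k} | hits chi c N < 4 * q]| * 2 ^ (4 * q)
  <= k ^ #|T|.
Proof.
move=> k0 ck leN; set B := [set _ | _].
have NT : #|N| <= #|T| by apply: max_card.
have : #|B| * 2 ^ (#|N| - 4 * q) <= (2 * k).-1 ^ #|N| * k ^ (#|T| - #|N|).
  have <- : 1 + k.-1 * 2 = (2 * k).-1 by lia.
  rewrite -(sum_weights 1 2 N ck); apply: markov_count => chi hchi.
  by rewrite sum_weights_expn exp1n mul1n leq_exp2l //; lia.
have hN : 2 ^ (8 * q) * (2 * k).-1 ^ #|N| <= (2 * k) ^ #|N|.
  have : 2 ^ (8 * q) * (2 * k).-1 ^ (2 * k * (8 * q)) <= (2 * k) ^ (2 * k * (8 * q)).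
    rewrite !(expnM _ (2 * k)) -expnMn; apply: expn_mono.
    have {2 3 4}-> : 2 * k = (2 * k).-1.+1 by lia.
    exact: expn_double_pred.
  have leN' : 2 * k * (8 * q) <= #|N| by lia.
  have split r : r ^ #|N| = r ^ (2 * k * (8 * q)) * r ^ (#|N| - 2 * k * (8 * q)).
    by rewrite -expnD subnKC.
  by move=> h; rewrite !split mulnA; apply: leq_mul h _; apply: expn_mono; lia.
have {2}-> : #|T| = #|N| + (#|T| - #|N|) by lia.
rewrite expnD; set y := k ^ (_ - _) => hB.
rewrite expnMn in hN.
have e1 : 2 ^ #|N| = 2 ^ (#|N| - 4 * q) * 2 ^ (4 * q).
  by rewrite -expnD subnK //; nia.
have e2 : 2 ^ (8 * q) = 2 ^ (4 * q) * 2 ^ (4 * q) by rewrite -expnD; congr (_ ^ _); lia.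
rewrite e1 e2 in hN.
have z0 : 0 < 2 ^ (4 * q) by rewrite expn_gt0.
have w0 : 0 < 2 ^ (#|N| - 4 * q) by rewrite expn_gt0.
move: hB hN z0 w0; set z := 2 ^ (4 * q); set w := 2 ^ _; set a := (2 * k).-1 ^ _.
set b := k ^ _ => hB hN z0 w0.
have hN' : z * a <= w * b.
  by rewrite -(leq_pmul2l z0); apply: leq_trans (_ : z * z * a <= _); nia.
rewrite -(leq_pmul2r w0).
apply: leq_trans (_ : z * (a * y) <= _); first by rewrite mulnAC [_ * z]mulnC leq_mul2l hB orbT.
by rewrite mulnA [X in _ <= X]mulnC mulnA leq_mul2r hN' orbT.
Qed.

Definition recolour chi (u : T) (a : 'I_k) : {ffun T -> 'I_k} :=
  [ffun w => if w == u then a else chi w].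

(** Since [P] ignores the colour of [u], recolouring [u] freely turns the colourings with
    [chi u = chi v] into all those satisfying [P], each obtained once. *)
Lemma card_agree (P : pred {ffun T -> 'I_k}) (u v : T) : u != v ->
    (forall chi a, P (recolour chi u a) = P chi) ->
  #|[set chi | P chi & chi u == chi v]| * k = #|[set chi | P chi]|.
Proof.
move=> uv Pu; set S := [set _ | _ & _].
have -> : [set chi | P chi] =
    [set recolour x.1 u x.2 | x in setX S [set: 'I_k]].
  apply/setP=> chi; rewrite inE; apply/idP/imsetP => [Pchi|[[psi a] /=]].
    exists (recolour chi u (chi v), chi u).
      by rewrite !inE /= Pu Pchi !ffunE eqxx [v == u]eq_sym (negbTE uv) eqxx.
    by apply/ffunP=> w; rewrite !ffunE; case: eqP => [->|].
  by rewrite !inE => /andP[/andP[Ppsi _] _] ->; rewrite Pu.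
rewrite card_in_imset ?cardsX ?cardsT ?card_ord // => -[x a] [y b] /=.
rewrite !inE => /andP[/andP[_ /eqP xu] _] /andP[/andP[_ /eqP yu] _] /ffunP xy.
have ab : a = b by have := xy u; rewrite !ffunE eqxx.
have off w : w != u -> x w = y w by move=> /negbTE wu; have := xy w; rewrite !ffunE wu.
congr (_, _) => //; apply/ffunP=> w; have [->|/off //] := eqVneq w u.
by rewrite xu yu off // eq_sym.
Qed.

Definition monochromatic chi (uv : T * T) : bool := chi uv.1 == chi uv.2.

Lemma card_monochromatic (uv : T * T) : uv.1 != uv.2 ->
  #|[set chi : {ffun T -> 'I_k} | monochromatic chi uv]| * k = k ^ #|T|.
Proof.
move=> uvN; have := @card_agree predT uv.1 uv.2 uvN (fun _ _ => erefl).
by rewrite [X in _ = X](_ : _ = k ^ #|T|) // cardsT card_ffun card_ord.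
Qed.

(** Edges that differ even when undirected leave an endpoint of [f] off [e]; recolouring that
    endpoint makes the two events independent. *)
Lemma card_monochromatic2 (e f : T * T) : e.1 != e.2 -> f.1 != f.2 -> e != f ->
    f != (e.2, e.1) ->
  #|[set chi : {ffun T -> 'I_k} | monochromatic chi e & monochromatic chi f]|
    * (k * k) = k ^ #|T|.
Proof.
case: e f => [a b] [c d] /= ab cd ef fe.
have fresh x y : x != y -> x \notin [:: a; b] ->
  #|[set chi : {ffun T -> 'I_k} | monochromatic chi (a, b) & chi x == chi y]|
    * (k * k) = k ^ #|T|.
  move=> xy; rewrite !inE negb_or => /andP[xa xb].
  rewrite mulnA card_agree // ?card_monochromatic // => chi i.
  by rewrite /monochromatic !ffunE /= ![_ == x]eq_sym (negbTE xa) (negbTE xb).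
have [cN|/negPn cab] := boolP (c \notin [:: a; b]); first exact: fresh.
have [dN|/negPn dab] := boolP (d \notin [:: a; b]).
  rewrite -(fresh d c) // 1?eq_sym //; congr (_ * _); apply: eq_card => chi.
  by rewrite !inE /monochromatic /= [chi c == _]eq_sym.
move: cab dab ef fe cd; rewrite !inE !xpair_eqE.
by move=> /orP[]/eqP-> /orP[]/eqP->; rewrite ?eqxx ?andbT //= ?andbF ?eqxx.
Qed.

Lemma sum_card_set (I J : finType) (A : {set I}) (p : I -> pred J) :
  \sum_j #|[set i in A | p i j]| = \sum_(i in A) #|[set j | p i j]|.
Proof.
transitivity (\sum_j \sum_(i in A) (p i j : nat)).
  apply: eq_bigr => j _; rewrite -sum1_card [RHS](bigID (p^~ j)) /=.
  rewrite [X in _ + X]big1 ?addn0 => [|i /andP[_ /negbTE -> //]].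
  rewrite (eq_bigl (fun i => (i \in A) && p i j)) => [|i]; last by rewrite inE.
  by apply: eq_bigr => i /andP[_ ->].
rewrite exchange_big; apply: eq_bigr => i _.
rewrite -sum1_card [LHS](bigID (p i)) /=.
rewrite [X in _ + X]big1 ?addn0 => [|j /negbTE -> //].
rewrite [RHS](eq_bigl (p i)) => [|j]; last by rewrite inE.
by apply: eq_bigr => j ->.
Qed.

(* Chebyshev: distinct edges are monochromatic pairwise independently. *)
Lemma monochromatic_tail (E : {set T * T}) (n : nat) : 0 < k -> 0 < n ->
    (forall e, e \in E -> e.1 != e.2 /\ (e.2, e.1) \notin E) ->
    #|E| <= n * k ->
  #|[set chi : {ffun T -> 'I_k} | 32 * n < #|[set e in E | monochromatic chi e]| ]|
    * (961 * n) <= k ^ #|T|.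
Proof.
move=> k0 n0 EP leE; set B := [set _ | _]; set Z := k ^ #|T|.
pose M chi := #|[set e in E | monochromatic chi e]|.
have M1 : k * (\sum_chi M chi) = #|E| * Z.
  rewrite sum_card_set mulnC big_distrl /= (eq_bigr (fun=> Z)) => [|e eE].
    by rewrite sum_nat_const.
  by apply: card_monochromatic; case: (EP e eE).
have M2 : k * k * (\sum_chi M chi * M chi) = #|E| * (k * Z) + #|E| * (#|E|.-1 * Z).
  transitivity (\sum_(e in E) \sum_(f in E)
      #|[set chi : {ffun T -> 'I_k} | monochromatic chi e & monochromatic chi f]| * (k * k)).
    under [RHS]eq_bigr => e _ do rewrite -big_distrl /=.
    rewrite -[RHS]big_distrl /= mulnC; congr (_ * _).
    transitivity (\sum_chi \sum_(e in E | monochromatic chi e) M chi).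
      apply: eq_bigr => chi _; rewrite sum_nat_const; congr (_ * _).
      by apply: eq_card => e; rewrite !inE.
    rewrite (exchange_big_dep (mem E)) /=; last by move=> chi e _ /andP[].
    apply: eq_bigr => e eE.
    rewrite -(sum_card_set E (fun f chi => monochromatic chi e && monochromatic chi f)).
    rewrite eE big_mkcond /=; apply: eq_bigr => chi _.
    case: (monochromatic chi e); first by apply: eq_card => f; rewrite !inE.
    by rewrite (_ : [set _ in _ | _] = set0) ?cards0 //; apply/setP=> f; rewrite !inE andbF.
  transitivity (\sum_(e in E) (k * Z + #|E|.-1 * Z)); last first.
    by rewrite sum_nat_const mulnDr.
  apply: eq_bigr => e eE; have [ee eN] := EP e eE.
  rewrite (bigD1 e) //=; congr (_ + _).
    rewrite mulnA (_ : [set _ | _ & _] = [set chi | monochromatic chi e]).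
      by rewrite card_monochromatic // mulnC.
    by apply/setP=> chi; rewrite !inE andbb.
  rewrite (eq_bigr (fun=> Z)) => [|f /andP[fE fe]].
    rewrite sum_nat_const; congr (_ * _).
    rewrite (cardsD1 e E) eE /=; apply: eq_card => f; by rewrite !inE andbC.
  have [ff fN] := EP f fE.
  apply: card_monochromatic2 => //; first by rewrite eq_sym.
  by apply: contraNneq eN => <-.
(* The squared deviation of [k * M chi] from [#|E|] is bounded below pointwise, rearranged to avoid
   subtraction. On [B] the deviation is at least 32nk - nk = 31nk, whence 961 = 31^2. *)
have key chi : 2 * #|E| * (k * M chi) + (chi \in B) * (31 * n * k * (31 * n * k))
    <= k * k * (M chi * M chi) + #|E| * #|E|.
  rewrite inE -/(M chi); case: ltnP => [lt|_]; last first.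
    have [+ _] := nat_Cauchy (k * M chi) #|E|.
    rewrite expnMn -!mulnn mul0n addn0.
    by rewrite -[X in _ -> X <= _]mulnA [X in _ -> 2 * X <= _]mulnC.
  have : #|E| + 31 * n * k <= k * M chi by nia.
  rewrite mul1n; set x := 31 * n * k; set y := k * M chi => h.
  have -> : k * k * (M chi * M chi) = y * y by rewrite /y; nia.
  by rewrite -(subnK h); set z := y - _; nia.
have : 2 * #|E| * (k * \sum_chi M chi) + #|B| * (31 * n * k * (31 * n * k))
    <= k * k * (\sum_chi M chi * M chi) + Z * (#|E| * #|E|).
  have -> : #|B| = \sum_chi (chi \in B : nat).
    rewrite -sum1_card [LHS]big_mkcond; apply: eq_bigr => chi _; by case: (_ \in _).
  have -> : Z * (#|E| * #|E|) = \sum_(chi : {ffun T -> 'I_k}) #|E| * #|E|.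
    by rewrite sum_nat_const card_ffun card_ord.
  rewrite !big_distrr !big_distrl -!big_split /=; apply: leq_sum => chi _; exact: key.
rewrite {}M1 {}M2; clear key; move: #|B| Z leE; clear EP B M.
move: #|E| => E0 b Z leE h.
have kk0 : 0 < n * k * k by rewrite !muln_gt0 n0 k0.
rewrite -(leq_pmul2r kk0).
apply: leq_trans (_ : E0 * (k * Z) <= _).
  have : E0 * (E0.-1 * Z) <= E0 * (E0 * Z) by rewrite !leq_mul // leq_pred.
  lia.
have : E0 * (k * Z) <= n * k * (k * Z) by rewrite leq_mul.
lia.
Qed.

End Colourings.

(** * Peeling *)

Section Peeling.

Variables (n : nat) (e : rel 'I_n).
Implicit Types (g : rel 'I_n) (u v : 'I_n) (C R X Y : {set 'I_n}).

Definition residual C : rel 'I_n := fun u v => [&& e u v, u \notin C & v \notin C].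

Definition nbrs g v : {set 'I_n} := [set u | g v u].

(** The thresholds are 2^(top - 1), ..., 2^(top - i). Truncated subtraction keeps them positive, so
    a vertex without surviving neighbours is never added. *)
Fixpoint peel g (top i : nat) : {set 'I_n} :=
  if i is j.+1 then
    peel g top j :|: [set v | 2 ^ (top - i) <= #|nbrs g v :\: peel g top j|]
  else set0.

Definition class_rel C (col : 'I_n -> nat) (c : nat) : rel 'I_n :=
  fun u v => [&& residual C u v, col u == c & col v == c].

Definition class_load C col c : nat :=
  #|[set uv in edges e | class_rel C col c uv.1 uv.2]|.

(** Class [c] is handled by machine [c], hence [c < p]. A class with more than [cap] edges is
    skipped, so that memory limits hold for all coins. *)
Definition peeled (p cap top i : nat) C col : {set 'I_n} :=
  \bigcup_(c < p | class_load C col c <= cap) peel (class_rel C col c) top i.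

Definition trim (T : nat) C : {set 'I_n} :=
  C :|: [set v | T <= #|nbrs (residual C) v|].

Lemma peelS g top i : peel g top i \subset peel g top i.+1.
Proof. exact: subsetUl. Qed.

Lemma peel_class C col c top i v : v \in peel (class_rel C col c) top i -> col v = c.
Proof.
elim: i => [|i IHi] /=; first by rewrite inE.
rewrite in_setU => /orP[/IHi //|]; rewrite inE => h.
have /card_gt0P[u] := leq_trans (expn_gt0 2 _) h.
by rewrite !inE => /andP[_ /and3P[_ /eqP]].
Qed.

Lemma double_count g X Y (a b : nat) :
    (forall v, v \in X -> a <= #|[set u in Y | g v u]|) ->
    (forall u, u \in Y -> #|[set v in X | g v u]| <= b) ->
  a * #|X| <= b * #|Y|.
Proof.
move=> Xa Yb; apply: leq_trans (_ : \sum_(v in X) #|[set u in Y | g v u]| <= _).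
  by rewrite mulnC -sum_nat_const; apply: leq_sum.
have -> : \sum_(v in X) #|[set u in Y | g v u]| = \sum_(u in Y) #|[set v in X | g v u]|.
  rewrite -(sum_card_set Y (fun u v => (v \in X) && g v u)) [LHS]big_mkcond.
  apply: eq_bigr => v _; case: ifP => h; first by apply: eq_card => u; rewrite !inE.
  by rewrite (_ : [set _ in _ | _] = set0) ?cards0 //; apply/setP=> u; rewrite !inE andbF.
by rewrite mulnC -sum_nat_const; apply: leq_sum.
Qed.

Hypotheses (e_sym : symmetric e) (cover : {set 'I_n}).
Hypothesis coverP : forall u v, e u v -> (u \in cover) || (v \in cover).

Lemma residual_sym C : symmetric (residual C).
Proof. by move=> u v; rewrite /residual e_sym [(u \notin C) && _]andbC. Qed.

Lemma residual_nbrsS C R v : C \subset R -> nbrs (residual R) v \subset nbrs (residual C) v.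
Proof.
move=> /subsetP CR; apply/subsetP=> u; rewrite !inE /residual.
by case/and3P=> -> vR uR; rewrite (contra (CR v)) ?(contra (CR u)).
Qed.

Definition degree_lt C (d : nat) : bool := [forall v, #|nbrs (residual C) v| < d].

Lemma trim_degree (d : nat) C : 0 < d -> degree_lt (trim d C) d.
Proof.
move=> d0; apply/forallP => v; rewrite ltnNge; apply/negP => h.
have /card_gt0P[u] := leq_trans d0 h; rewrite inE => /and3P[_ /negP + _]; apply.
rewrite inE; apply/orP; right; rewrite inE; apply: leq_trans h _.
by apply/subset_leq_card/residual_nbrsS/subsetUl.
Qed.

(** A trimmed vertex outside the cover has at least 2^(delta - 1) residual neighbours, all in the
    cover, whose own degrees are below 2^delta. For [delta = 0] the threshold is still 1, and no
    degree reaches it. *)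
Lemma trim_charge (delta : nat) C : degree_lt C (2 ^ delta) ->
  #|trim (2 ^ delta.-1) C :\: cover| <= #|C :\: cover| + 2 * (0 < delta) * #|cover|.
Proof.
move=> /forallP deg; set X := [set v | 2 ^ delta.-1 <= #|nbrs (residual C) v|].
have -> : trim (2 ^ delta.-1) C :\: cover = (C :\: cover) :|: (X :\: cover).
  by rewrite -setDUl.
apply: leq_trans (leq_card_setU _ _) _; rewrite leq_add2l /X {X}.
case: delta deg => [|d] deg /=; set X := [set v | _].
  rewrite (_ : X :\: cover = set0) ?cards0 //; apply/setP=> v; rewrite !inE.
  by rewrite leqNgt deg andbF.
have : 2 ^ d * #|X :\: cover| <= 2 ^ d.+1 * #|cover|.
  apply: (@double_count (residual C)) => [v|u _].
    rewrite !inE => /andP[vO] /leq_trans; apply; apply/subset_leq_card/subsetP => u.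
    rewrite !inE => h; rewrite h andbT; case/and3P: h => /coverP + _ _.
    by rewrite (negbTE vO).
  apply: leq_trans (ltnW (deg u)); apply/subset_leq_card/subsetP => v.
  by rewrite !inE residual_sym => /andP[].
by rewrite expnS -mulnA mulnCA leq_pmul2l ?expn_gt0.
Qed.

Variables (C : {set 'I_n}) (delta kappa L : nat).
Hypothesis (deg : degree_lt C (2 ^ delta)).
Local Notation top := (delta - 2 - kappa).
Local Notation h := (residual C).

(* An idealised peeling, independent of the colouring, which knows the cover:
   the first component collects vertices of the cover, the second one the
   other vertices. *)
Fixpoint ideal (i : nat) : {set 'I_n} * {set 'I_n} :=
  if i is j.+1 then
    ((ideal j).1 :|:
       [set v in cover | 2 ^ (delta - i) <= #|nbrs h v :\: (cover :|: (ideal j).2)|],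
     (ideal j).2 :|:
       [set v | (v \notin cover) && (2 ^ (delta - 4 - i) <= #|nbrs h v :&: (cover :\: (ideal j).1)|)])
  else (set0, set0).

Definition in_degree_set j v := nbrs h v :\: (cover :|: (ideal j).2).
Definition out_degree_set j v := nbrs h v :&: (cover :\: (ideal j).1).

Lemma ideal_outside i v : v \in (ideal i).2 -> v \notin cover.
Proof.
elim: i => [|i IHi] /=; first by rewrite inE.
by rewrite in_setU => /orP[/IHi //|]; rewrite inE => /andP[].
Qed.

(** A vertex added in step i + 1 has at least 2^(delta - 5 - i) surviving neighbours in the cover.
    Each of these escaped the previous threshold and has at most 2^(delta - i) surviving neighbours
    outside. The ratio is 32. *)
Lemma ideal_card i : i + 4 <= delta -> #|(ideal i).2| <= 32 * i * #|cover|.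
Proof.
elim: i => [|i IHi] iL; first by rewrite cards0.
set X := (ideal i.+1).2 :\: (ideal i).2.
suff hX : #|X| <= 32 * #|cover|.
  rewrite -(setID (ideal i.+1).2 (ideal i).2) -/X.
  apply: leq_trans (leq_card_setU _ _) _; rewrite (setIidPr _) ?subsetUl //.
  have := IHi ltac:(lia); lia.
have dc : 2 ^ (delta - 4 - i.+1) * #|X| <= 2 ^ (delta - i) * #|cover :\: (ideal i).1|.
  apply: (@double_count h) => [v|u].
    rewrite !inE => /andP[/negbTE ->] /= /andP[_] /leq_trans; apply.
    by apply/subset_leq_card/subsetP => u; rewrite !inE andbC.
  rewrite !inE => /andP[uP uO].
  (* Before the first step the degree bound 2^delta replaces the previous threshold. *)
  case: i @X iL {IHi} uP => [|i] X iL uP.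
    rewrite subn0; apply: leq_trans (ltnW (forallP deg u)).
    by apply/subset_leq_card/subsetP => v; rewrite !inE residual_sym => /andP[].
  have : ~~ (2 ^ (delta - i.+1) <= #|nbrs h u :\: (cover :|: (ideal i).2)|).
    by move: uP; rewrite /= !inE uO negb_or => /andP[].
  rewrite -ltnNge => /ltnW; apply: leq_trans; apply/subset_leq_card/subsetP => v.
  rewrite inE => /andP[]; rewrite inE => /andP[vQ vQ'] hvu.
  rewrite in_setD in_setU negb_or inE residual_sym hvu andbT.
  by rewrite (ideal_outside vQ') (contra _ vQ) // => vQi; rewrite /= in_setU vQi.
have : 2 ^ (delta - 4 - i.+1) * #|X| <= 2 ^ (delta - 4 - i.+1) * (32 * #|cover|).
  apply: leq_trans dc _; rewrite mulnA (_ : _ * 32 = 2 ^ (delta - i)).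
    by rewrite leq_mul2l subset_leq_card ?orbT // subsetDl.
  by rewrite -(expnD 2 _ 5); congr (_ ^ _); lia.
by rewrite leq_pmul2l ?expn_gt0.
Qed.

Variables (k : nat) (chi : {ffun 'I_n -> 'I_k}).
Let col v : nat := chi v.

(** For [k = 2 ^ kappa] the class threshold 2^(top - i) is a quarter of the mean number of hits at
    ideal threshold 2^(delta - i), and four times the mean at 2^(delta - 4 - i). This leaves room
    for deviations on both sides. *)
Hypothesis many_hits : forall j v (c : 'I_k), j < L ->
  2 ^ (delta - j.+1) <= #|in_degree_set j v| ->
  2 ^ (top - j.+1) <= hits chi c (in_degree_set j v).
Hypothesis few_hits : forall j v (c : 'I_k), j < L ->
  #|out_degree_set j v| < 2 ^ (delta - 4 - j.+1) ->
  hits chi c (out_degree_set j v) < 2 ^ (top - j.+1).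

(** The inclusions support each other: few removals outside the cover leave cover vertices enough
    sampled neighbours to be removed, and many removals in the cover leave outside vertices few. *)
Lemma peel_sandwich i (c : 'I_k) : i <= L ->
  (forall v, chi v = c -> v \in (ideal i).1 -> v \in peel (class_rel C col c) top i) /\
  (forall v, v \notin cover -> v \in peel (class_rel C col c) top i -> v \in (ideal i).2).
Proof.
elim: i => [|i IHi] iL; first by split=> v _; rewrite inE.
have [IH1 IH2] := IHi (ltnW iL); split=> v vc.
  rewrite [(ideal _).1]/= in_setU => /orP[vP|].
    by apply: (subsetP (peelS _ _ _)); apply: IH1.
  rewrite inE => /andP[vO /(many_hits c iL) hv].
  rewrite [peel _ _ _]/= in_setU; apply/orP; right; rewrite inE; apply: leq_trans hv _.
  apply/subset_leq_card/subsetP => u.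
  rewrite inE => /andP[]; rewrite !inE negb_or => /andP[/andP[uO uQ] huv] /eqP uc.
  rewrite /class_rel /col huv vc uc !eqxx !andbT.
  by apply/negP => /(IH2 _ uO); apply/negP.
rewrite [peel _ _ _]/= in_setU => /orP[/(IH2 _ vc) vQ|].
  by rewrite [(ideal _).2]/= in_setU vQ.
rewrite inE => hv; rewrite [(ideal _).2]/= in_setU; apply/orP; right; rewrite inE vc /=.
rewrite leqNgt; apply/negP => /(few_hits c iL); rewrite ltnNge => /negP; apply.
apply: leq_trans hv _; apply/subset_leq_card/subsetP => u.
rewrite !inE /class_rel => /andP[uR /and3P[huv _ uc]]; rewrite huv /=.
rewrite /col in uc; rewrite uc andbT; apply/andP; split; last first.
  by case/and3P: huv => /coverP; rewrite (negbTE vc).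
by apply: contraNN uR => uP; apply: IH1 => //; apply/val_inj/eqP.
Qed.

Hypothesis L_gt0 : 0 < L.
Hypothesis L_le : L + 4 <= delta.
Variables (p cap : nat).
Hypothesis k_le : k <= p.
Hypothesis loads : forall c : 'I_k, class_load C col c <= cap.

(** Outside the cover, peeled vertices are ideal removals by the sandwich. The remaining neighbours
    of a trimmed vertex lie in the cover and survived their class, hence also the ideal peeling; so
    the vertex meets the condition of the last ideal step. *)
Lemma phase_charge :
  #|trim (2 ^ (delta - 4 - L)) (C :|: peeled p cap top L C col) :\: cover|
    <= #|C :\: cover| + 32 * L * #|cover|.
Proof.
apply: leq_trans (_ : #|(C :\: cover) :|: (ideal L).2| <= _); last first.
  by apply: leq_trans (leq_card_setU _ _) _; rewrite leq_add2l ideal_card.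
apply/subset_leq_card/subsetP => v; rewrite in_setD => /andP[vO].
rewrite in_setU; set C1 := C :|: _.
have [vC1 _|vC1 /=] := boolP (v \in C1).
  move: vC1; rewrite !in_setU in_setD vO => /orP[-> //|/bigcupP[c _ vR]].
  have vc := peel_class vR; have ck : c < k by rewrite -vc; exact: ltn_ord (chi v).
  have [_ sub] := peel_sandwich (Ordinal ck) (leqnn L).
  by rewrite (sub v vO vR) orbT.
rewrite inE => hv; rewrite in_setU; apply/orP; right.
(* The last ideal step counts cover vertices left after [L.-1] steps, so the sandwich is applied
   there. *)
have Li : L = L.-1.+1 by rewrite prednK.
rewrite Li [(ideal _).2]/= in_setU; apply/orP; right; rewrite inE vO /= -Li.
apply: leq_trans hv _; apply/subset_leq_card/subsetP => u; rewrite !inE => /and3P[evu _ uC1].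
have := uC1; rewrite in_setU negb_or => /andP[uC uR].
have := vC1; rewrite in_setU negb_or => /andP[vC _].
have uO : u \in cover by have := coverP evu; rewrite (negbTE vO).
rewrite /residual evu uC vC uO /= andbT; apply: contraNN uR => uP.
apply/bigcupP; exists (widen_ord k_le (chi u)); first exact: loads.
rewrite Li; apply: (subsetP (peelS _ _ _)).
by apply: (peel_sandwich (chi u) (leq_pred L)).1.
Qed.

End Peeling.

(** * Failure probability of a phase *)

Lemma union_bound (I J : finType) (B : I -> {set J}) (a b : nat) :
  (forall i, #|B i| * a <= b) -> #|\bigcup_i B i| * a <= #|I| * b.
Proof.
move=> Bi; apply: leq_trans (_ : (\sum_i #|B i|) * a <= _).
  rewrite leq_mul2r; apply/orP; right.
  elim/big_rec2: _ => [|i x X _ IH]; first by rewrite cards0.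
  by apply: leq_trans (leq_card_setU _ _) _; rewrite leq_add2l.
by rewrite big_distrl /= -sum_nat_const; apply: leq_sum.
Qed.

Lemma union_bound2 (J : finType) (A B : {set J}) (a b c d : nat) :
  #|A| * a <= b * d -> #|B| * a <= c * d -> #|A :|: B| * a <= (b + c) * d.
Proof.
move=> hA hB; rewrite mulnDl; apply: leq_trans (leq_add hA hB).
by rewrite -mulnDl leq_mul2r leq_card_setU orbT.
Qed.

Lemma log_bounds n : 0 < n -> 2 ^ log n <= n < 2 ^ (log n).+1.
Proof. by move=> n0; exact: trunc_log_bounds. Qed.

Definition vals (I : finType) (k : nat) (chi : {ffun I -> 'I_k}) (i : I) : nat := chi i.

Section PhaseProbability.

Variables (n l : nat).
Hypotheses (n_gt1 : 1 < n) (l_large : 16 * (log n).+1 <= 2 ^ l).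

Lemma l_gt3 : 3 < l.
Proof.
have lg : 0 < log n by rewrite /log trunc_log_gt0.
have : 2 ^ 4 < 2 ^ l by apply: leq_trans l_large; lia.
by rewrite ltn_exp2l // => /ltnW.
Qed.

(** Thresholds of at least 2^l turn the Chernoff bounds into failure probabilities n^(-8), which
    survive polynomial union bounds. *)
Lemma tail_large q : 2 ^ l <= 4 * q -> n ^ 8 <= 2 ^ (2 * q).
Proof.
move=> hq; have /andP[_ hn] := log_bounds (ltnW n_gt1).
apply: leq_trans (_ : (2 ^ (log n).+1) ^ 8 <= _); first exact/expn_mono/ltnW.
by rewrite -expnM leq_exp2l; lia.
Qed.

Section Tails.

Variables (T : finType) (kappa : nat).
Local Notation k := (2 ^ kappa).

Lemma few_tail (N : {set T}) (c : 'I_k) a : l <= a -> #|N| <= 2 ^ (kappa + a - 2) ->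
  #|[set chi : {ffun T -> 'I_k} | 2 ^ a <= hits chi c N]| * n ^ 8 <= k ^ #|T|.
Proof.
have l3 := l_gt3; move=> la leN; have ea : 2 ^ a = 4 * 2 ^ (a - 2).
  by rewrite -(expnD 2 2); congr (_ ^ _); lia.
have large : n ^ 8 <= 2 ^ (2 * 2 ^ (a - 2)) by rewrite tail_large // -ea leq_exp2l.
apply: leq_trans (leq_mul (leqnn _) large) _.
rewrite ea; apply: hits_upper_tail; rewrite ?expn_gt0 //.
by rewrite -expnD addnBA //; lia.
Qed.

Lemma many_tail (N : {set T}) (c : 'I_k) a : l <= a -> 2 ^ (kappa + a + 2) <= #|N| ->
  #|[set chi : {ffun T -> 'I_k} | hits chi c N < 2 ^ a]| * n ^ 8 <= k ^ #|T|.
Proof.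
have l3 := l_gt3; move=> la leN; have ea : 2 ^ a = 4 * 2 ^ (a - 2).
  by rewrite -(expnD 2 2); congr (_ ^ _); lia.
have large : n ^ 8 <= 2 ^ (4 * 2 ^ (a - 2)).
  apply: leq_trans (@tail_large (2 ^ (a - 2)) _) _; first by rewrite -ea leq_exp2l.
  by rewrite leq_exp2l // leq_mul2r orbT.
apply: leq_trans (leq_mul (leqnn _) large) _.
rewrite ea; apply: hits_lower_tail; rewrite ?expn_gt0 //.
apply: leq_trans leN; rewrite -(expnD 2 4) -expnD leq_exp2l //; lia.
Qed.

End Tails.

Variables (e : rel 'I_n) (cover : {set 'I_n}).
Hypothesis e_sym : symmetric e.
Hypothesis coverP : forall u v, e u v -> (u \in cover) || (v \in cover).

Variables (p kappa delta : nat).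
Local Notation k := (2 ^ kappa).
Local Notation top := (delta - 2 - kappa).

(** If positive, the last step has threshold 2^l, the smallest to which the tail bounds apply. *)
Definition layers : nat := top - l.
(** After sampling this is the exponent of the last ideal threshold, namely [kappa + l - 2]. Without
    layers, exact trimming halves the degree. *)
Definition next_delta : nat := if 0 < layers then delta - 4 - layers else delta.-1.

Definition phase (col : 'I_n -> nat) (C : {set 'I_n}) : {set 'I_n} :=
  trim e (2 ^ next_delta) (C :|: peeled e p (32 * n) top layers C col).

(** The second conjunct is a potential argument: each halving of the degree pays for [32 * #|cover|]
    vertices outside the cover. *)
Definition phase_ok (col : 'I_n -> nat) (C : {set 'I_n}) : bool :=
  degree_lt e (phase col C) (2 ^ next_delta) &&
  (#|phase col C :\: cover| + 32 * next_delta * #|cover|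
     <= #|C :\: cover| + 32 * delta * #|cover|).

Variable C : {set 'I_n}.
Hypothesis deg : degree_lt e C (2 ^ delta).
Hypotheses (kappa_le : kappa <= (log n).+1) (delta_le : delta <= (log n).+1).

Lemma phase_ok_plain col : layers = 0 -> phase_ok col C.
Proof.
move=> L0; rewrite /phase_ok {1}/phase trim_degree ?expn_gt0 //=.
rewrite /phase /next_delta L0 /=.
rewrite (_ : peeled _ _ _ _ _ _ _ = set0) ?setU0; last exact: big1.
apply: leq_trans (leq_add (trim_charge e_sym coverP deg) (leqnn _)) _.
by rewrite -addnA leq_add2l -mulnDl leq_mul2r; apply/orP; right; lia.
Qed.

(** The colourings that violate [many_hits] or [few_hits] for some layer, vertex and colour. *)
Definition bad_hits : {set {ffun 'I_n -> 'I_k}} :=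
  \bigcup_(x : 'I_layers * 'I_n * 'I_k) (
    [set chi | (2 ^ (delta - x.1.1.+1) <= #|in_degree_set e cover C delta x.1.1 x.1.2|)
             && (hits chi x.2 (in_degree_set e cover C delta x.1.1 x.1.2) < 2 ^ (top - x.1.1.+1))]
    :|: [set chi | (#|out_degree_set e cover C delta x.1.1 x.1.2| < 2 ^ (delta - 4 - x.1.1.+1))
             && (2 ^ (top - x.1.1.+1) <= hits chi x.2 (out_degree_set e cover C delta x.1.1 x.1.2))]).

Lemma k_le : k <= 2 * n.
Proof.
have /andP[hn _] := log_bounds (ltnW n_gt1).
apply: leq_trans (_ : 2 ^ (log n).+1 <= _); first by rewrite leq_exp2l.
by rewrite expnS leq_mul2l.
Qed.

Lemma layers_le : layers <= n.
Proof.
have := trunc_log_ltn 2 n_gt1; have := trunc_logP (isT : 1 < 2) (ltnW n_gt1).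
have := ltn_expl (log n) (isT : 1 < 2).
rewrite /layers /log; move: delta_le; rewrite /log; lia.
Qed.

(** Union bound over at most [n * n * (2 * n)] triples with two events each. *)
Lemma bad_hits_card : #|bad_hits| * n ^ 8 <= 4 * n ^ 3 * k ^ n.
Proof.
apply: leq_trans (_ : #|{: 'I_layers * 'I_n * 'I_k}| * ((1 + 1) * k ^ n) <= _).
  apply: union_bound => -[[j v] c] /=.
  move: (nat_of_ord j) (ltn_ord j) => {}j; rewrite /layers => jL.
  apply: union_bound2; rewrite mul1n.
    case: (leqP (2 ^ (delta - j.+1))) => [hN|_]; last by rewrite eq_card0 // => chi; rewrite !inE.
    rewrite /= -[X in _ <= _ ^ X]card_ord; apply: many_tail; first by lia.
    by apply: leq_trans hN; rewrite leq_exp2l //; lia.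
  case: (ltnP _ (2 ^ (delta - 4 - j.+1))) => [hN|_]; last by rewrite eq_card0 // => chi; rewrite !inE.
  rewrite /= -[X in _ <= _ ^ X]card_ord; apply: few_tail; first by lia.
  by apply: leq_trans (ltnW hN) _; rewrite leq_exp2l //; lia.
rewrite !card_prod !card_ord mulnA leq_mul2r; apply/orP; right.
have := k_le; have := layers_le; rewrite (expnS n 2) -mulnn.
move: layers k => L K hL hK.
have : L * n * K <= n * n * (2 * n) by rewrite !leq_mul.
lia.
Qed.

Lemma phase_ok_good (chi : {ffun 'I_n -> 'I_k}) : 0 < layers -> k <= p ->
    chi \notin bad_hits ->
    (forall c : 'I_k, class_load e C (vals chi) c <= 32 * n) ->
  phase_ok (vals chi) C.
Proof.
move=> L0 kp chiB loads; rewrite /phase_ok {1}/phase trim_degree ?expn_gt0 //=.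
have l3 := l_gt3; have Ld : layers + 4 <= delta by rewrite /layers in L0 *; lia.
rewrite /phase /next_delta L0.
apply: leq_trans (leq_add (phase_charge e_sym coverP deg _ _ L0 Ld kp loads) (leqnn _)) _.
- move=> j v c jL hN; rewrite leqNgt; apply/negP => hlt; case/negP: chiB.
  by apply/bigcupP; exists (Ordinal jL, v, c) => //=; rewrite !inE hN hlt.
- move=> j v c jL hN; rewrite ltnNge; apply/negP => hlt; case/negP: chiB.
  by apply/bigcupP; exists (Ordinal jL, v, c) => //=; rewrite !inE hN hlt orbT.
by rewrite -addnA leq_add2l -mulnDl leq_mul2r; apply/orP; right; lia.
Qed.

(** Each load is at most the number of monochromatic edges, which exceeds 32n with probability at
    most 1/(961n); [bad_hits] adds at most 1/(4n). *)
Lemma phase_fail_first : 2 < n -> 0 < layers -> k <= p -> #|edges e| <= n * k ->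
  #|[set chi : {ffun 'I_n -> 'I_k} | ~~ phase_ok (vals chi) C]| * (2 * n) <= k ^ n.
Proof.
move=> n2 L0 kp ek.
pose E := [set uv in edges e | residual e C uv.1 uv.2].
pose B := [set chi : {ffun 'I_n -> 'I_k} | 32 * n < #|[set uv in E | monochromatic chi uv]| ].
have hB : #|B| * (961 * n) <= k ^ n.
  rewrite -[X in _ <= _ ^ X]card_ord; apply: monochromatic_tail; rewrite ?expn_gt0 //.
  - by apply: ltn_trans n_gt1.
  - move=> [u v]; rewrite !inE /= => /andP[/andP[uv euv] _]; split; last first.
      by rewrite ltnNge (ltnW uv).
    by apply: contraTneq uv => ->; rewrite ltnn.
  by apply: leq_trans ek; apply/subset_leq_card/subsetP => uv; rewrite inE => /andP[].
have sub : [set chi | ~~ phase_ok (vals chi) C] \subset bad_hits :|: B.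
  apply/subsetP=> chi; rewrite inE; apply: contraNT; rewrite in_setU negb_or => /andP[h1 h2].
  apply: phase_ok_good => // c; move: h2; rewrite inE -leqNgt; apply: leq_trans.
  apply/subset_leq_card/subsetP => uv; rewrite !inE.
  by case/andP=> -> /and3P[-> /eqP uc /eqP vc]; apply/eqP/val_inj; rewrite /= [LHS]uc [RHS]vc.
apply: leq_trans (_ : (#|bad_hits| + #|B|) * (2 * n) <= _).
  by rewrite leq_mul2r (leq_trans (subset_leq_card sub)) ?orbT ?leq_card_setU.
have n2' : 9 <= n ^ 2 by rewrite -mulnn; nia.
have h1 : #|bad_hits| * (4 * n) <= k ^ n.
  have n30 : 0 < n ^ 3 * 4 by rewrite muln_gt0 expn_gt0; lia.
  have := bad_hits_card; rewrite [4 * _]mulnC => h; rewrite -(leq_pmul2l n30).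
  apply: leq_trans h; rewrite mulnCA leq_mul2l; apply/orP; right.
  rewrite (_ : n ^ 8 = n ^ 3 * (n * (n ^ 2 * n ^ 2))); last by rewrite -expnD -expnS -expnD.
  rewrite (_ : n ^ 3 * 4 * (4 * n) = n ^ 3 * (n * (4 * 4))); last by lia.
  by rewrite !leq_mul // (leq_trans _ n2').
nia.
Qed.

(** Loads are bounded by the number of vertices of a class times their degrees within it, both
    controlled by Chernoff bounds. *)
Lemma phase_fail_later : 2 < n -> (0 < layers -> k <= p) -> delta <= kappa.*2 ->
  #|[set chi : {ffun 'I_n -> 'I_k} | ~~ phase_ok (vals chi) C]| * n ^ 2 <= k ^ n.
Proof.
move=> n2 kp dk; case: (posnP layers) => [L0|L0].
  by rewrite eq_card0 // => chi; rewrite !inE phase_ok_plain.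
have l3 := l_gt3; have Lb := L0; rewrite /layers in Lb.
(* Off [B1] and [B2] a class has at most 2^a vertices, with at most 2^b neighbours each in the
   class. As [delta <= kappa.*2], the product is at most 32 * 2^(log n) <= 32n. *)
pose a := (log n).+3 - kappa; pose b := delta + 2 - kappa.
pose B1 := \bigcup_(c : 'I_k) [set chi : {ffun 'I_n -> 'I_k} | 2 ^ a <= hits chi c [set: 'I_n]].
pose B2 := \bigcup_(x : 'I_n * 'I_k)
  [set chi : {ffun 'I_n -> 'I_k} | 2 ^ b <= hits chi x.2 (nbrs (residual e C) x.1)].
have /andP[nlo nhi] := log_bounds (ltnW n_gt1).
have hB1 : #|B1| * n ^ 8 <= 2 * n * k ^ n.
  apply: leq_trans (_ : #|{: 'I_k}| * k ^ n <= _); last by rewrite card_ord leq_mul2r k_le orbT.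
  apply: union_bound => c; rewrite -[X in _ <= _ ^ X]card_ord; apply: few_tail; first by rewrite /a; lia.
  rewrite cardsT card_ord; apply: leq_trans (ltnW nhi) _; rewrite leq_exp2l // /a; lia.
have hB2 : #|B2| * n ^ 8 <= 2 * n ^ 2 * k ^ n.
  apply: leq_trans (_ : #|{: 'I_n * 'I_k}| * k ^ n <= _).
    apply: union_bound => -[v c]; rewrite -[X in _ <= _ ^ X]card_ord; apply: few_tail.
      by rewrite /b; lia.
    apply: leq_trans (ltnW (forallP deg v)) _; rewrite leq_exp2l // /b; lia.
  rewrite card_prod !card_ord leq_mul2r; apply/orP; right.
  by have := k_le; rewrite -mulnn; nia.
have sub : [set chi | ~~ phase_ok (vals chi) C] \subset bad_hits :|: (B1 :|: B2).
  apply/subsetP=> chi; rewrite inE; apply: contraNT.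
  rewrite !in_setU !negb_or => /and3P[h0 h1 h2].
  apply: phase_ok_good => //; first exact: kp.
  move=> c; pose V := [set u : 'I_n in [set: 'I_n] | chi u == c :> nat].
  have hV : #|V| <= 2 ^ a.
    apply: ltnW; rewrite ltnNge; apply: contraNN h1 => h1.
    by apply/bigcupP; exists c => //; rewrite inE.
  apply: leq_trans (_ : \sum_(v in V) 2 ^ b <= _); last first.
    rewrite sum_nat_const; apply: leq_trans (_ : 2 ^ a * 2 ^ b <= _).
      by rewrite leq_mul2r hV orbT.
    apply: leq_trans (_ : 2 ^ 5 * 2 ^ log n <= _); last by rewrite leq_mul2l.
    by rewrite -!expnD leq_exp2l // /a /b; lia.
  apply: leq_trans (_ : \sum_(v in V) hits chi c (nbrs (residual e C) v) <= _); last first.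
    apply: leq_sum => v _; apply: ltnW; rewrite ltnNge; apply: contraNN h2 => h2.
    by apply/bigcupP; exists (v, c) => //; rewrite inE.
  (* The edges of the class are counted by their smaller endpoint. *)
  rewrite /class_load -sum1_card (partition_big fst (mem V)) /=; last first.
    by move=> uv; rewrite !inE => /andP[_ /and3P[]].
  apply: leq_sum => v _; rewrite sum1dep_card.
  rewrite -(@card_in_imset _ _ snd) => [|[x y] [x' y']]; last first.
    by rewrite !inE /= => /andP[_ /eqP->] /andP[_ /eqP->] ->.
  apply/subset_leq_card/subsetP => u /imsetP[[x y] /=].
  rewrite !inE /class_rel /= => /andP[/andP[_ /and3P[hxy _ yc]] /eqP <-] ->.
  by rewrite hxy; apply: yc.
apply: leq_trans (_ : (#|bad_hits| + (#|B1| + #|B2|)) * n ^ 2 <= _).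
  rewrite leq_mul2r; apply/orP; right; apply: leq_trans (subset_leq_card sub) _.
  apply: leq_trans (leq_card_setU _ _) _; rewrite leq_add2l; exact: leq_card_setU.
have h0 := bad_hits_card.
have n60 : 0 < n ^ 6 by rewrite expn_gt0; lia.
rewrite -(leq_pmul2r n60) -mulnA -(expnD n 2 6).
apply: leq_trans (_ : (4 * n ^ 3 + (2 * n + 2 * n ^ 2)) * k ^ n <= _).
  by rewrite [leqLHS]mulnDl [in leqLHS]mulnDl [leqRHS]mulnDl [in leqRHS]mulnDl !leq_add.
rewrite [leqRHS]mulnC leq_mul2r; apply/orP; right.
rewrite (_ : n ^ 6 = n ^ 3 * n ^ 3); last by rewrite -expnD.
have n3 : 27 <= n ^ 3 by apply: (@expn_mono 3 3).
apply: leq_trans (_ : 8 * n ^ 3 <= _); last by rewrite leq_mul2r (leq_trans _ n3) ?orbT.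
have : n ^ 1 <= n ^ 3 by rewrite leq_pexp2l // ltnW.
have : n ^ 2 <= n ^ 3 by rewrite leq_pexp2l // ltnW.
by rewrite expn1; move: (n ^ 2) (n ^ 3) => a3 b3; lia.
Qed.

End PhaseProbability.

(** * The algorithm *)

Section Words.

Variable n : nat.
Implicit Types (ws mem : seq nat) (es : seq ('I_n * 'I_n)) (C : {set 'I_n}).

Definition edge_word (uv : 'I_n * 'I_n) : nat := uv.1 + n * uv.2.

Definition word_edge (x : nat) : option ('I_n * 'I_n) :=
  if (insub (x %% n), insub (x %/ n)) is (Some u, Some v) then Some (u, v) else None.

(** Packing an edge into one word frees half of the memory taken by the input. *)
Fixpoint pair_up ws : seq nat :=
  if ws is u :: v :: ws' then u + n * v :: pair_up ws' else [::].

Definition mset ws : {set 'I_n} := [set v | val v \in ws].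

(* A word u + n q, with u < n, is a value q attached to the vertex u. *)
Definition vertex_sum ws (v : 'I_n) : nat := \sum_(x <- ws | x %% n == v) x %/ n.

(** Residues modulo 3 tell edges, removed vertices and auxiliary words apart in one sequence. *)
Definition tagged (t : nat) ws : seq nat := [seq 3 * x + t | x <- ws].
Definition untag (t : nat) mem : seq nat := [seq x %/ 3 | x <- mem & x %% 3 == t].

Definition store es C ws : seq nat :=
  tagged 0 (map edge_word es) ++ tagged 1 (map val (enum C)) ++ tagged 2 ws.

Definition stored_edges mem := pmap word_edge (untag 0 mem).
Definition stored_set mem := mset (untag 1 mem).
Definition stored_words mem := untag 2 mem.

Lemma word_modn (v : 'I_n) q : (v + n * q) %% n = v.
Proof. by rewrite addnC mulnC modnMDl modn_small. Qed.

Lemma word_divn (v : 'I_n) q : (v + n * q) %/ n = q.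
Proof.
have n0 : 0 < n by apply: leq_ltn_trans (ltn_ord v).
by rewrite addnC mulnC divnMDl // divn_small ?addn0.
Qed.

Lemma edge_wordK : pcancel edge_word word_edge.
Proof. by case=> u v; rewrite /word_edge /edge_word /= word_modn word_divn !valK. Qed.

Lemma edge_word_inj : injective edge_word.
Proof. exact: pcan_inj edge_wordK. Qed.

Lemma pair_up_edges es :
  pair_up (flatten [seq [:: val uv.1; val uv.2] | uv <- es]) = map edge_word es.
Proof. by elim: es => //= uv es ->. Qed.

Lemma untag_tagged t t' ws : t < 3 -> t' < 3 ->
  untag t (tagged t' ws) = if t' == t then ws else [::].
Proof.
move=> t3 t3'; rewrite /untag /tagged filter_map /=.
rewrite (eq_filter (a2 := fun=> t' == t)) => [|x /=]; last first.
  by rewrite mulnC modnMDl modn_small.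
case: eqP => _; last by rewrite filter_pred0.
rewrite filter_predT -map_comp map_id_in // => x _ /=.
by rewrite mulnC divnMDl // divn_small ?addn0.
Qed.

Lemma untag_cat t ws ws' : untag t (ws ++ ws') = untag t ws ++ untag t ws'.
Proof. by rewrite /untag filter_cat map_cat. Qed.

Lemma store_edgesK es C ws : stored_edges (store es C ws) = es.
Proof.
rewrite /stored_edges /store !untag_cat !untag_tagged //= !cats0.
exact: (map_pK edge_wordK).
Qed.

Lemma mset_enum C : mset (map val (enum C)) = C.
Proof. by apply/setP=> v; rewrite inE mem_map ?mem_enum //; apply: val_inj. Qed.

Lemma store_setK es C ws : stored_set (store es C ws) = C.
Proof. by rewrite /stored_set /store !untag_cat !untag_tagged //= cats0 mset_enum. Qed.

Lemma store_wordsK es C ws : stored_words (store es C ws) = ws.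
Proof. by rewrite /stored_words /store !untag_cat !untag_tagged. Qed.

Lemma size_store es C ws : size (store es C ws) <= size es + n + size ws.
Proof.
rewrite /store !size_cat !size_map -cardE -addnA leq_add2l leq_add2r.
by rewrite -[leqRHS]card_ord max_card.
Qed.

Lemma edge_word_lt uv : edge_word uv < n ^ 2.
Proof.
case: uv => u v; rewrite /edge_word /= -mulnn.
have := ltn_ord u; have := ltn_ord v; nia.
Qed.

Lemma store_words_lt es C ws W : 3 * n ^ 2 <= W -> all (fun x => 3 * x.+1 <= W) ws ->
  all (is_word W) (store es C ws).
Proof.
move=> nW wsW; rewrite /store !all_cat !all_map; apply/and3P; split.
- by apply/allP=> uv _; rewrite /= /is_word; have := edge_word_lt uv; lia.
- apply/allP=> v _; rewrite /= /is_word; have := ltn_ord v; rewrite -mulnn in nW; nia.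
- by apply: sub_all wsW => x; rewrite /= /is_word; lia.
Qed.

End Words.

(** * The program of a machine *)

Section Program.

Variables (n p l : nat) (kap del : nat -> nat).
Implicit Types (i j c : 'I_p) (u v : 'I_n) (ws mem : seq nat).
Implicit Types (es : seq ('I_n * 'I_n)) (C : {set 'I_n}).

Definition gather (inbox : 'I_p -> seq nat) : seq nat :=
  flatten [seq inbox j | j <- enum 'I_p].

Definition owned j : seq 'I_n := [seq v : 'I_n <- enum 'I_n | v %% p == j].

Definition alive C (uv : 'I_n * 'I_n) : bool := (uv.1 \notin C) && (uv.2 \notin C).

Definition local_class es C (col : 'I_n -> nat) (c : nat) :=
  [seq uv <- es | [&& alive C uv, col uv.1 == c & col uv.2 == c]].

Definition local_degree es C v : nat :=
  count (fun uv => alive C uv && ((uv.1 == v) || (uv.2 == v))) es.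

Definition word_graph ws : rel 'I_n :=
  fun u v => (edge_word (u, v) \in ws) || (edge_word (v, u) \in ws).

(** The coin type is the same in all rounds, so colours are drawn from one large power of two and
    reduced modulo that of the phase, which keeps them uniform. *)
Definition colour_bits : nat := (log n).+1.
Definition coins : finType := {ffun 'I_n -> 'I_(2 ^ colour_bits)}.

Lemma coins_inhabited : 0 < #|coins|.
Proof. by rewrite card_ffun !card_ord !expn_gt0. Qed.

(* A phase takes eight rounds.  The messages are: the random colours; the
   number of local edges of each colour class; whether a class is small enough
   to be collected; the edges of the class; its peeled vertices, to their
   owners; all peeled vertices; the local degrees, to the owners; the vertices
   that are trimmed. *)
Definition phase_step (ph t : nat) i (x : coins) es C (cols inbox : seq nat) :
    seq nat * ('I_p -> seq nat) :=
  match t with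
  | 0 => (store es (C :|: mset n inbox) [::],
          fun=> [seq v + n * (x v %% 2 ^ kap ph) | v : 'I_n <- owned i])
  | 1 => (store es C inbox, fun c => [:: size (local_class es C (vertex_sum inbox) c)])
  | 2 => (store es C cols, fun=> if sumn inbox <= 32 * n then [:: val i] else [::])
  | 3 => (store es C [::],
          fun c => if val c \in inbox
                   then map (@edge_word n) (local_class es C (vertex_sum cols) c) else [::])
  | 4 => let R := peel (word_graph inbox) (del ph - 2 - kap ph)
                    (layers l (kap ph) (del ph)) in
         (store es C [::], fun j => [seq val v | v <- owned j & v \in R])
  | 5 => (store es C [::], fun=> [seq val v | v <- owned i & val v \in inbox])
  | 6 => let C' := C :|: mset n inbox in
         (store es C' [::], fun j => [seq v + n * local_degree es C' v | v : 'I_n <- owned j])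
  | _ => (store es C [::],
          fun=> [seq val v | v <- owned i & 2 ^ del ph.+1 <= vertex_sum inbox v])
  end.

Definition step (r : nat) i (x : coins) mem (inbox : 'I_p -> seq nat) :
    seq nat * ('I_p -> seq nat) :=
  if r is r'.+1 then
    phase_step (r' %/ 8) (r' %% 8) i x (stored_edges n mem) (stored_set n mem)
      (stored_words mem) (gather inbox)
  else (tagged 0 (pair_up n mem), fun=> [::]).

(** The vertices trimmed in the last round are still in the inbox. *)
Definition output i mem (inbox : 'I_p -> seq nat) : {set 'I_n} :=
  stored_set n mem :|: mset n (gather inbox).

Definition peeling_algorithm (memory phases : nat) : mpc_algorithm n :=
  MPCAlgorithm memory (8 * phases).+1 coins_inhabited step output.

End Program.

(** * Local knowledge and the residual graph *)

Section Distributed.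

Variables (n : nat) (e : rel 'I_n).

Lemma peel_ext (g g' : rel 'I_n) top i : g =2 g' -> peel g top i = peel g' top i.
Proof.
move=> gg'; elim: i => //= i ->; congr (_ :|: _); apply/setP=> v; rewrite !inE.
by rewrite (_ : nbrs g v = nbrs g' v) //; apply/setP=> u; rewrite !inE.
Qed.

(** For machines whose class was too large: they receive no edges and peel nothing. *)
Lemma peel_empty (g : rel 'I_n) top i : (forall u v, g u v = false) -> peel g top i = set0.
Proof.
move=> g0; elim: i => //= i ->; rewrite set0U; apply/setP=> v; rewrite !inE.
rewrite (_ : _ :\: _ = set0) ?cards0; last by apply/setP=> u; rewrite !inE g0 andbF.
by rewrite leqn0 expn_eq0.
Qed.

Lemma phase_ext l p kappa delta (col col' : 'I_n -> nat) C : col =1 col' ->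
  phase l e p kappa delta col C = phase l e p kappa delta col' C.
Proof.
move=> cc; have cr c : class_rel e C col c =2 class_rel e C col' c.
  by move=> u v; rewrite /class_rel !cc.
rewrite /phase /peeled; congr (trim _ _ (_ :|: _)); apply: eq_big => c.
  by rewrite /class_load; congr (_ <= _); apply: eq_card => uv; rewrite !inE cr.
by move=> _; apply: peel_ext.
Qed.

Lemma card_edges (P : pred ('I_n * 'I_n)) : count P (enum (edges e)) = #|[set uv in edges e | P uv]|.
Proof.
rewrite -size_filter -(card_uniqP _); last by rewrite filter_uniq ?enum_uniq.
by apply: eq_card => uv; rewrite inE mem_filter mem_enum andbC.
Qed.

Variable (p : nat).
Variable inp : 'I_p -> seq ('I_n * 'I_n).
Hypothesis dist : perm_eq (flatten [seq inp i | i : 'I_p]) (enum (edges e)).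

Lemma sum_count (P : pred ('I_n * 'I_n)) :
  \sum_(i < p) count P (inp i) = #|[set uv in edges e | P uv]|.
Proof.
rewrite -card_edges -(permP dist) count_flatten -map_comp /= sumnE big_map.
by rewrite big_enum.
Qed.

Lemma sum_local_class C col c :
  \sum_(i < p) size (local_class (inp i) C col c) = class_load e C col c.
Proof.
under eq_bigr => i _ do rewrite size_filter.
rewrite sum_count; apply: eq_card => uv; rewrite !inE /class_rel /residual /alive.
by case: (_ < _) => //=; case: (e _ _).
Qed.

Hypotheses (e_sym : symmetric e) (e_irr : irreflexive e).

(** Each edge is stored once, on one machine, as an increasing pair; [f] maps a neighbour of [v] to
    that pair. *)
Lemma sum_local_degree C v :
  \sum_(i < p) local_degree (inp i) C v = #|nbrs (residual e C) v|.
Proof.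
rewrite sum_count; pose f (u : 'I_n) := if u < v then (u, v) else (v, u).
rewrite -(card_in_imset (f := f)) => [|u u' _ _].
  apply: eq_card => -[a b]; rewrite !inE /alive /=; apply/idP/imsetP => [|[u]].
    case/andP=> /andP[ab eab] /andP[/andP[aC bC]] /orP[]/eqP hv; subst v.
      exists b; first by rewrite inE /residual eab aC bC.
      by rewrite /f ltnNge (ltnW ab).
    exists a; first by rewrite inE /residual e_sym eab aC bC.
    by rewrite /f ab.
  rewrite inE /residual => /and3P[evu vC uC]; rewrite /f; case: ltnP => uv [-> ->].
    by rewrite uv e_sym evu uC vC eqxx orbT.
  rewrite evu uC vC eqxx /= !andbT ltn_neqAle uv andbT.
  by apply: contraTneq evu => /val_inj ->; rewrite e_irr.
by rewrite /f; do 2!case: ltnP => _; case=> //; congruence.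
Qed.

Lemma mem_inp i uv : uv \in inp i -> uv.1 < uv.2 /\ e uv.1 uv.2.
Proof.
move=> h; have : uv \in enum (edges e).
  by rewrite -(perm_mem dist); apply/flatten_mapP; exists i; rewrite ?mem_enum.
by rewrite mem_enum inE => /andP[].
Qed.

Lemma mem_class C col c uv :
  (uv \in flatten [seq local_class (inp i) C col c | i : 'I_p])
  = (uv.1 < uv.2) && class_rel e C col c uv.1 uv.2.
Proof.
rewrite /class_rel /residual; apply/flatten_mapP/idP => [[i _]|].
  rewrite mem_filter => /andP[/and3P[/andP[-> ->] -> ->] /mem_inp[-> ->]] //.
case/and4P=> uv12 /and3P[euv uC vC] uc vc.
have : uv \in enum (edges e) by rewrite mem_enum inE uv12.
rewrite -(perm_mem dist) => /flatten_mapP[i _ hi]; exists i; first exact: mem_enum.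
by rewrite mem_filter /alive uC vC uc vc hi.
Qed.

Definition class_words C col c : seq nat :=
  flatten [seq map (@edge_word n) (local_class (inp i) C col c) | i : 'I_p].

Lemma word_graph_class C col c : word_graph (class_words C col c) =2 class_rel e C col c.
Proof.
have memw uv : (edge_word uv \in class_words C col c) =
    (uv.1 < uv.2) && class_rel e C col c uv.1 uv.2.
  rewrite -mem_class -(mem_map (@edge_word_inj n)); congr (_ \in _).
  by rewrite /class_words map_flatten -map_comp.
move=> u v; rewrite /word_graph !memw /= /class_rel [residual e C v u]residual_sym //.
rewrite [(col v == c) && _]andbC -andb_orl; case: ltngtP => //= uv.
by rewrite /residual (val_inj uv) e_irr.
Qed.

Hypothesis p_gt0 : 0 < p.

Definition owner (v : 'I_n) : 'I_p := Ordinal (ltn_pmod v p_gt0).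

Lemma mem_owned j v : (v \in owned n j) = (owner v == j).
Proof. by rewrite mem_filter mem_enum andbT. Qed.

(** Vertices of one owner agree modulo [p], so their quotients are distinct. *)
Lemma size_owned (j : 'I_p) : size (owned n j) <= (n %/ p).+1.
Proof.
rewrite -[(n %/ p).+1]card_ord -(card_uniqP _); last by rewrite filter_uniq ?enum_uniq.
have lt (v : 'I_n) : v %/ p < (n %/ p).+1 by rewrite ltnS leq_div2r // ltnW.
apply: (@leq_card_in _ _ (fun v => Ordinal (lt v))) => u v.
rewrite !mem_owned => /eqP uj /eqP vj /(congr1 val) /= uv; apply: val_inj => /=.
rewrite (divn_eq u p) (divn_eq v p) uv; congr (_ + _).
by rewrite -[u %% p]/(val (owner u)) uj -vj.
Qed.

Lemma sum_owned (P : pred 'I_n) (j : 'I_p) (f : 'I_n -> nat) :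
  \sum_(v <- owned n j | P v) f v = \sum_(v | (owner v == j) && P v) f v.
Proof. by rewrite big_filter_cond big_enum_cond; apply: eq_bigl => v. Qed.

Lemma vertex_sum_map (s : seq 'I_n) (f : 'I_n -> nat) v :
  vertex_sum [seq u + n * f u | u : 'I_n <- s] v = \sum_(u <- s | u == v) f u.
Proof.
rewrite /vertex_sum big_map; apply: congr_big => // u; last by rewrite word_divn.
by rewrite word_modn.
Qed.

Lemma vertex_sum_owned (f : 'I_n -> nat) j v :
  vertex_sum [seq u + n * f u | u : 'I_n <- owned n j] v = if owner v == j then f v else 0.
Proof.
rewrite vertex_sum_map sum_owned; case: ifP => vj.
  by rewrite (big_pred1 v) // => u /=; have [->|] := eqVneq u v; rewrite ?vj ?andbF.
by rewrite big_pred0 // => u /=; have [->|] := eqVneq u v; rewrite ?vj ?andbF.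
Qed.

Lemma vertex_sum_flatten (J : finType) (F : J -> seq nat) (v : 'I_n) :
  vertex_sum (flatten [seq F j | j : J]) v = \sum_j vertex_sum (F j) v.
Proof. by rewrite /vertex_sum big_flatten big_map big_enum. Qed.

Lemma mset_owned (P : 'I_p -> pred 'I_n) :
  mset n (flatten [seq [seq val v | v <- owned n j & P j v] | j : 'I_p])
  = [set v | P (owner v) v].
Proof.
apply/setP=> v; rewrite !inE; apply/flatten_mapP/idP => [[j _]|h].
  rewrite mem_map; last exact: val_inj.
  by rewrite mem_filter mem_owned => /andP[+ /eqP vj]; rewrite vj.
exists (owner v); first exact: mem_enum.
rewrite mem_map; last exact: val_inj.
by rewrite mem_filter mem_owned h eqxx.
Qed.

End Distributed.

(** * Chains of random rounds *)

Section Chain.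

Variables (X : finType) (S : Type) (next : nat -> X -> S -> S) (good : nat -> S -> bool).

Fixpoint iterate (r : nat) (xs : seq X) (s : S) : S :=
  if xs is x :: xs' then iterate r.+1 xs' (next r x s) else s.

Lemma card_tuple_cons N (P : pred (seq X)) :
  #|[set w : N.+1.-tuple X | P w]| = \sum_(x : X) #|[set w : N.-tuple X | P (x :: w)]|.
Proof.
pose f (xw : X * N.-tuple X) : N.+1.-tuple X := [tuple of xw.1 :: xw.2].
pose g (w : N.+1.-tuple X) := (thead w, [tuple of behead w]).
have fK : cancel f g by case=> x w; congr (_, _); apply: val_inj.
have gK : cancel g f by move=> w; rewrite /f /g /= [RHS]tuple_eta.
rewrite -sum1dep_card (reindex f) /=; last by exists g => ? _.
rewrite -(pair_big_dep predT (fun x w => P (x :: val w)) (fun _ _ => 1)) /=.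
by apply: eq_bigr => x _; rewrite sum1dep_card.
Qed.

Import GRing.Theory Num.Theory Order.TTheory.
Local Open Scope ring_scope.

Variable eps : nat -> rat.
Hypothesis eps_ge0 : forall r, 0 <= eps r.
Hypothesis step_fail : forall r s, good r s ->
  (#|[set x | ~~ good r.+1 (next r x s)]|%:R <= eps r * #|X|%:R :> rat).

(** Induction on the first coin: if it fails, all continuations are counted; otherwise the induction
    hypothesis applies to the new good state. No conditional probabilities are required. *)
Lemma chain_fail N r s : good r s ->
  #|[set w : N.-tuple X | ~~ good (r + N) (iterate r w s)]|%:R
    <= (\sum_(i < N) eps (r + i)) * #|X|%:R ^+ N.
Proof.
elim: N r s => [|N IHN] r s gs.
  rewrite big_ord0 mul0r eq_card0 // => w; rewrite !inE tuple0 /= addn0 gs //.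
have e0 N' r' : 0 <= \sum_(i < N') eps (r' + i) by apply: sumr_ge0 => i _.
rewrite (card_tuple_cons N (fun w => ~~ good (r + N.+1)%N (iterate r w s))) natr_sum.
rewrite (bigID (fun x => good r.+1 (next r x s))) /=.
rewrite big_ord_recl addn0 mulrDl addrC; apply: lerD.
  apply: le_trans (_ : \sum_(x | ~~ good r.+1 (next r x s)) #|X|%:R ^+ N <= _).
    apply: ler_sum => x _; rewrite -natrX ler_nat -card_tuple; exact: max_card.
  rewrite sumr_const -[_ *+ _]mulr_natr exprS mulrA [leLHS]mulrC ler_wpM2r ?exprn_ge0 //.
  by have := step_fail gs; rewrite cardsE.
apply: le_trans (_ : \sum_(x : X) (\sum_(i < N) eps (r.+1 + i)) * #|X|%:R ^+ N <= _).
  rewrite [leRHS](bigID (fun x => good r.+1 (next r x s))) /= -[leLHS]addr0.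
  apply: lerD; last by apply: sumr_ge0 => x _; rewrite mulr_ge0 ?e0 ?exprn_ge0 ?ler0n.
  by apply: ler_sum => x gx; rewrite addnS -addSn; apply: IHN.
rewrite sumr_const -[_ *+ _]mulr_natr -mulrA -exprSr.
by under [in leRHS]eq_bigr => i _ do rewrite /= /bump add1n addnS -addSn.
Qed.

End Chain.

(** * Uniform colourings from the coins of the machines *)

Section Fibre.

Variables (I V : finType) (K k : nat) (own : V -> I).
Hypotheses (k_gt0 : 0 < k) (k_dvd : k %| K).

Definition chosen_colours (x : {ffun I -> {ffun V -> 'I_K}}) : {ffun V -> 'I_k} :=
  [ffun v => Ordinal (ltn_pmod (x (own v) v) k_gt0)].

Lemma card_residue (c : 'I_k) : #|[set a : 'I_K | a %% k == c]| = K %/ k.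
Proof.
pose f (q : 'I_(K %/ k)) : nat := q * k + c.
have f_lt q : f q < K.
  rewrite -(divnK k_dvd) /f; apply: leq_trans (_ : q.+1 * k <= _); last by rewrite leq_mul2r ltn_ord orbT.
  by rewrite mulSn addnC ltn_add2r.
rewrite -[RHS]card_ord -[RHS](@card_imset _ _ (fun q => Ordinal (f_lt q)));
  last by move=> q q' /(congr1 val) /= /eqP;
    rewrite /f eqn_add2r eqn_mul2r eqn0Ngt k_gt0 /= => /eqP/val_inj.
apply: eq_card => a; rewrite inE; apply/eqP/imsetP => [ac|[q _ ->] /=]; last first.
  by rewrite /f modnMDl modn_small.
have q_lt : a %/ k < K %/ k by rewrite ltn_divLR // divnK.
by exists (Ordinal q_lt) => //; apply: val_inj; rewrite /= /f /= -ac -divn_eq.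
Qed.

(** The residue of the owner's draw for each vertex is prescribed and all other draws are free. The
    count does not depend on [chi], so the colouring is uniform. *)
Lemma card_fibre (chi : {ffun V -> 'I_k}) :
  #|[set x | chosen_colours x == chi]| = \prod_(i : I) \prod_(v : V) (if own v == i then K %/ k else K).
Proof.
(* The indicator of the fibre is a product of 0-1 factors, so its sum over all draws factors too. *)
pose F i (y : {ffun V -> 'I_K}) := \prod_(v : V) ((own v == i) ==> (y v %% k == chi v) : nat).
transitivity (\sum_(x : {ffun I -> {ffun V -> 'I_K}}) \prod_i F i (x i)).
  rewrite -sum1dep_card big_mkcond /=; apply: eq_bigr => x _.
  case: eqP => [chix|neq].
    rewrite big1 // => i _; rewrite /F big1 // => v _.
    by apply/eqP; rewrite eqb1; apply/implyP => /eqP <-; rewrite -chix ffunE.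
  have [v vN] : exists v, chosen_colours x v != chi v.
    by apply/existsP; apply: contra_notT neq; rewrite negb_exists => /forallP h;
       apply/ffunP => v; apply/eqP; have := h v; rewrite negbK.
  rewrite (bigD1 (own v)) //= /F (bigD1 v) //= eqxx /=.
  by move: vN; rewrite ffunE -val_eqE /= => /negbTE ->.
rewrite -(bigA_distr_bigA F); apply: eq_bigr => i _; rewrite /F.
rewrite -(bigA_distr_bigA (fun v (a : 'I_K) => ((own v == i) ==> (a %% k == chi v) : nat))).
apply: eq_bigr => v _; case: ifP => vi /=; last by rewrite sum1_card card_ord.
rewrite -(card_residue (chi v)) -sum1dep_card [RHS]big_mkcond.
by apply: eq_bigr => a _ /=; case: (_ == _).
Qed.

Lemma card_chosen (Q : pred {ffun V -> 'I_k}) :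
  #|[set x | Q (chosen_colours x)]| * k ^ #|V|
    = #|[set chi | Q chi]| * #|{: {ffun I -> {ffun V -> 'I_K}}}|.
Proof.
set Z := \prod_(i : I) \prod_(v : V) (if own v == i then K %/ k else K).
have count (P : pred {ffun V -> 'I_k}) : #|[set x | P (chosen_colours x)]| = #|[set chi | P chi]| * Z.
  rewrite -sum1dep_card (partition_big chosen_colours P) //= -sum_nat_const.
  rewrite [RHS](eq_bigl P) => [|chi]; last by rewrite inE.
  apply: eq_bigr => chi Pchi; rewrite sum1dep_card /Z -(card_fibre chi); apply: eq_card => x.
  by rewrite !inE; case: eqP => [->|]; rewrite ?andbF // Pchi.
(* The trivial event yields the total number of draws as k^|V| times the fibre size. *)
have := count predT; rewrite !cardsT count => ->.
by rewrite [in RHS]card_ffun card_ord mulnCA mulnA mulnC mulnA mulnC [k ^ _ * _]mulnC.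
Qed.

End Fibre.

(** * Execution of the algorithm *)

Section Run.

Variables (n p l : nat) (kap del : nat -> nat) (phases : nat).
Let A := peeling_algorithm n p l kap del (128 * n) phases.
Variables (e : rel 'I_n) (inp : mpc_input A).
Hypotheses (e_sym : symmetric e) (e_irr : irreflexive e).
Hypothesis dist : distributes e inp.
Hypotheses (n_large : 100 <= n) (p_gt0 : 0 < p) (p_le : p <= 4 * n).
Hypothesis del_next : forall ph, del ph.+1 = next_delta l (kap ph) (del ph).
Let W := n ^ 4.
Implicit Types (c : mpc_config A) (C : {set 'I_n}) (ws : seq nat).

(** All machines hold the same removed set and auxiliary words; only edges and inboxes differ. *)
Definition at_state c C ws (inbox : 'I_p -> seq nat) : Prop :=
  forall i, (c i).1 = store (inp i) C ws /\ gather (c i).2 = inbox i.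

(* Between phases the vertices trimmed last are still in transit. *)
Definition at_boundary c C : Prop :=
  exists C0 (inbox : 'I_p -> seq nat),
    at_state c C0 [::] inbox /\ forall i, C0 :|: mset n (inbox i) = C.

Lemma inp_le i : size (inp i) <= 64 * n.
Proof. by have := dist.2 i; rewrite /A /=; lia. Qed.

Lemma act_phase ph t (x : round_coins A) c C ws inbox i : t < 8 -> at_state c C ws inbox ->
  act (t + ph * 8).+1 x c i = phase_step l kap del ph t i (x i) (inp i) C ws (inbox i).
Proof.
move=> t8 /(_ i)[mem_i inbox_i]; rewrite /act /= /step mem_i inbox_i.
rewrite store_edgesK store_setK store_wordsK divnDMl // divn_small //.
by rewrite [t + _]addnC modnMDl modn_small.
Qed.

Lemma owned_total : p * (n %/ p).+1 <= 5 * n.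
Proof. by rewrite mulnS mulnC; have := leq_trunc_div n p; lia. Qed.

(** * Effect and legality of one round *)

Section Round.

Variables (ph t : nat) (x : round_coins A) (c : mpc_config A) (C : {set 'I_n}).
Variables (ws : seq nat) (inbox : 'I_p -> seq nat).
Hypotheses (t_lt8 : t < 8) (at_c : at_state c C ws inbox).
Let res i := phase_step l kap del ph t i (x i) (inp i) C ws (inbox i).

Variables (C' : {set 'I_n}) (ws' : seq nat).
Hypotheses (mem_res : forall i, (res i).1 = store (inp i) C' ws').
Hypotheses (ws'_size : size ws' <= 5 * n) (ws'_word : all (fun a => a < n ^ 3) ws').
Hypothesis out_word : forall i j, all (fun a => a < n ^ 3) ((res i).2 j).

Lemma next_at_state :
  at_state (next_config (t + ph * 8).+1 x c) C' ws'
    (fun i => flatten [seq (res j).2 i | j : 'I_p]).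
Proof.
move=> i; split.
  by rewrite -[LHS]/(act (t + ph * 8).+1 x c i).1 (act_phase _ _ _ t_lt8 at_c) mem_res.
congr flatten; apply: eq_map => j.
by rewrite -[LHS]/((act (t + ph * 8).+1 x c j).2 i) (act_phase _ _ _ t_lt8 at_c).
Qed.

Lemma cube_words a : a < n ^ 3 -> 3 * a.+1 <= W.
Proof. by move=> h; apply: leq_trans (_ : n * n ^ 3 <= _); [apply: leq_mul; lia | rewrite -expnS]. Qed.

(** The budget is 128n words: communication takes at most 64n + 32n, memory at most 64n for edges, n
    for removed vertices, 5n for auxiliary words and 32n for incoming messages. *)
Lemma round_legal :
    (forall i, \sum_(j < p) size ((res i).2 j) <= 64 * n) ->
    (forall j, \sum_(i < p) size ((res i).2 j) <= 32 * n) ->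
  legal_round W (t + ph * 8).+1 x c.
Proof.
move=> hs hr i.
have sentE : sent (t + ph * 8).+1 x c i <= 64 * n.
  by apply: leq_trans (hs i); rewrite /sent (act_phase _ _ _ t_lt8 at_c).
have recvE : received (t + ph * 8).+1 x c i <= 32 * n.
  apply: leq_trans (hr i); apply: leq_sum => j _.
  by rewrite (act_phase _ _ _ t_lt8 at_c).
rewrite (act_phase _ _ _ t_lt8 at_c) -/(res i) mem_res /=; split.
- by apply: leq_trans (leq_add sentE recvE) _; lia.
- apply: leq_trans (leq_add (size_store _ _ _) recvE) _.
  have := inp_le i; lia.
- apply: store_words_lt; last by apply: sub_all ws'_word => a; exact: cube_words.
  apply: leq_trans (_ : n ^ 2 * n ^ 2 <= _); last by rewrite -expnD.
  by rewrite leq_mul2r; apply/orP; right; rewrite -mulnn; nia.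
- move=> j; apply: sub_all (out_word i j) => a /cube_words; rewrite /is_word; lia.
Qed.

(** Messages about the vertices of one owner are this short, and [p] of them have at most n + p <=
    5n words. *)
Lemma round_legal_small : (forall i j, size ((res i).2 j) <= (n %/ p).+1) ->
  legal_round W (t + ph * 8).+1 x c.
Proof.
move=> small; have total := owned_total; apply: round_legal => i.
  apply: leq_trans (_ : \sum_(j < p) (n %/ p).+1 <= _); first exact: leq_sum.
  by rewrite sum_nat_const card_ord; lia.
apply: leq_trans (_ : \sum_(j < p) (n %/ p).+1 <= _); first exact: leq_sum.
by rewrite sum_nat_const card_ord; lia.
Qed.

End Round.

(** * The eight rounds of a phase *)

Section Phase.

Variables (ph : nat) (xs : nat -> round_coins A) (C : {set 'I_n}).
Local Notation k := (2 ^ kap ph).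
Local Notation own := (owner p_gt0).
Let col v := xs 0 (own v) v %% k.
Let chosen := flatten [seq [seq v + n * (xs 0 j v %% k) | v : 'I_n <- owned n j] | j : 'I_p].
Let ok j := class_load e C col j <= 32 * n.
Let R j := if ok j then peel (class_rel e C col j) (del ph - 2 - kap ph) (layers l (kap ph) (del ph))
           else set0.

Lemma chosen_col : vertex_sum chosen =1 col.
Proof.
move=> v; rewrite /chosen vertex_sum_flatten (bigD1 (own v)) //= big1 => [|j jv].
  by rewrite (vertex_sum_owned p_gt0) eqxx addn0.
by rewrite (vertex_sum_owned p_gt0) eq_sym (negbTE jv).
Qed.

Lemma chosen_size : size chosen <= 5 * n.
Proof.
apply: leq_trans (owned_total); rewrite /chosen size_flatten /shape -map_comp sumnE big_map big_enum.
apply: leq_trans (_ : \sum_(j < p) (n %/ p).+1 <= _); last by rewrite sum_nat_const card_ord.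
by apply: leq_sum => j _; rewrite /= size_map; exact: size_owned.
Qed.

Lemma pow_colour : 2 ^ colour_bits n <= 2 * n.
Proof.
have /andP[hn _] : 2 ^ log n <= n < 2 ^ (log n).+1 by apply: log_bounds; lia.
by rewrite expnS leq_mul2l.
Qed.

Lemma vertex_word_lt (v : 'I_n) q : q <= 64 * n -> v + n * q < n ^ 3.
Proof.
have := ltn_ord v => hv hq; apply: leq_trans (_ : n * (1 + 64 * n) <= _); first by nia.
by rewrite expnS leq_mul2l -mulnn; apply/orP; right; nia.
Qed.

Lemma val_lt (v : 'I_n) : v < n ^ 3.
Proof. by have := vertex_word_lt v (leq0n _); rewrite muln0 addn0. Qed.

Lemma colour_word_lt (v : 'I_n) (y : coins n) : v + n * (y v %% k) < n ^ 3.
Proof.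
apply: vertex_word_lt; apply: leq_trans (leq_mod _ _) _.
have := ltn_ord (y v); have := pow_colour; lia.
Qed.

Lemma chosen_words : all (fun a => a < n ^ 3) chosen.
Proof.
apply/allP=> a /flatten_mapP[j _ /mapP[v _ ->]]; exact: colour_word_lt.
Qed.

Lemma round0 c : at_boundary c C ->
  legal_round W (0 + ph * 8).+1 (xs 0) c /\
  at_state (next_config (0 + ph * 8).+1 (xs 0) c) C [::] (fun=> chosen).
Proof.
case=> C0 [inbox [at_c absorb]].
have mem_res i : (phase_step l kap del ph 0 i (xs 0 i) (inp i) C0 [::] (inbox i)).1
    = store (inp i) C [::] by rewrite /= absorb.
split; last exact: (next_at_state (t := 0) isT at_c mem_res).
apply: (round_legal_small (t := 0) isT at_c mem_res) => // i j; last by rewrite /= size_map size_owned.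
by apply/allP=> a /mapP[v _ ->]; exact: colour_word_lt.
Qed.

Lemma round1 c : at_state c C [::] (fun=> chosen) ->
  legal_round W (1 + ph * 8).+1 (xs 1) c /\
  at_state (next_config (1 + ph * 8).+1 (xs 1) c) C chosen
    (fun j => flatten [seq [:: size (local_class (inp i) C (vertex_sum chosen) j)] | i : 'I_p]).
Proof.
move=> at_c.
have mem_res i : (phase_step l kap del ph 1 i (xs 1 i) (inp i) C [::] chosen).1
    = store (inp i) C chosen by [].
split; last exact: (next_at_state (t := 1) isT at_c mem_res).
apply: (round_legal_small (t := 1) isT at_c mem_res) => // [||i j].
- exact: chosen_size.
- exact: chosen_words.
rewrite /= andbT size_filter.
apply: leq_ltn_trans (count_size _ _) _; apply: leq_ltn_trans (inp_le i) _.
by apply: (@leq_trans (n * n ^ 2)); [rewrite -mulnn; nia | rewrite -expnS].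
Qed.

Lemma at_state_ext c C' ws inbox inbox' : inbox =1 inbox' ->
  at_state c C' ws inbox -> at_state c C' ws inbox'.
Proof. by move=> eq at_c i; rewrite -eq; exact: at_c. Qed.

Lemma load_chosen j :
  \sum_(i < p) size (local_class (inp i) C (vertex_sum chosen) j) = class_load e C col j.
Proof.
rewrite (sum_local_class dist.1); apply: eq_card => uv.
by rewrite !inE /class_rel !chosen_col.
Qed.

Let flags := flatten [seq if ok j then [:: val j] else [::] | j : 'I_p].

Lemma round2 c :
    at_state c C chosen
      (fun j => flatten [seq [:: size (local_class (inp i) C (vertex_sum chosen) j)] | i : 'I_p]) ->
  legal_round W (2 + ph * 8).+1 (xs 2) c /\
  at_state (next_config (2 + ph * 8).+1 (xs 2) c) C chosen (fun=> flags).
Proof.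
set inbox := (fun _ => _) => at_c.
have sum_inbox j : sumn (inbox j) = class_load e C col j.
  rewrite -load_chosen /inbox sumn_flatten -map_comp sumnE big_map big_enum /=.
  by apply: eq_bigr => i _; rewrite /= addn0.
have mem_res i : (phase_step l kap del ph 2 i (xs 2 i) (inp i) C chosen (inbox i)).1
    = store (inp i) C chosen by [].
have out_res i j : (phase_step l kap del ph 2 i (xs 2 i) (inp i) C chosen (inbox i)).2 j
    = if ok i then [:: val i] else [::] by rewrite /= sum_inbox.
split.
  apply: (round_legal_small (t := 2) isT at_c mem_res) => [||i j|i j].
  - exact: chosen_size.
  - exact: chosen_words.
  - rewrite out_res; case: ifP => // _; rewrite /= andbT.
    apply: leq_trans (ltn_ord i) _; apply: leq_trans p_le _.
    by apply: (@leq_trans (n * n ^ 2)); [rewrite -mulnn; nia | rewrite -expnS].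
  - by rewrite out_res; case: ifP.
apply: at_state_ext (next_at_state (t := 2) isT at_c mem_res) => j.
by congr flatten; apply: eq_map => i; rewrite out_res.
Qed.

Lemma mem_flags (j : 'I_p) : (val j \in flags) = ok j.
Proof.
apply/flatten_mapP/idP => [[i _]|okj]; last by exists j; rewrite ?mem_enum // okj inE.
by case: ifP => // oki; rewrite inE => /eqP/val_inj ->.
Qed.

Lemma class_disjoint es (f : 'I_n -> nat) : \sum_(j < p) size (local_class es C f j) <= size es.
Proof.
elim: es => [|uv es IHes]; first by rewrite big1.
apply: leq_trans (_ : \sum_(j < p) ((f uv.1 == j) + size (local_class es C f j)) <= _).
  apply: leq_sum => j _; rewrite /local_class /=; case: ifP => [/and3P[_ -> _] //|_].
  exact: leq_addl.
rewrite big_split /= -add1n leq_add //.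
case: (ltnP (f uv.1) p) => [lt|ge].
  rewrite (bigD1 (Ordinal lt)) //= eqxx big1 // => j.
  by rewrite -val_eqE eq_sym /= => /negbTE ->.
rewrite big1 // => j _; case: eqP => // fj.
by have := ltn_ord j; rewrite -fj ltnNge ge.
Qed.

Let collected j := if ok j then class_words inp C (vertex_sum chosen) j else [::].

(** The only round with long messages. An edge lies in at most one class, so a machine sends at most
    its own edges; the flags cap what it receives at 32n. *)
Lemma round3 c : at_state c C chosen (fun=> flags) ->
  legal_round W (3 + ph * 8).+1 (xs 3) c /\
  at_state (next_config (3 + ph * 8).+1 (xs 3) c) C [::] collected.
Proof.
move=> at_c.
have mem_res i : (phase_step l kap del ph 3 i (xs 3 i) (inp i) C chosen flags).1
    = store (inp i) C [::] by [].
have out_res i j : (phase_step l kap del ph 3 i (xs 3 i) (inp i) C chosen flags).2 j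
    = if ok j then map (@edge_word n) (local_class (inp i) C (vertex_sum chosen) j) else [::].
  by rewrite /= mem_flags.
split.
  apply: (round_legal (t := 3) isT at_c mem_res) => // [i j|i|j].
  - rewrite out_res; case: ifP => // _; rewrite all_map; apply/allP => uv _ /=.
    by apply: leq_trans (edge_word_lt uv) _; rewrite leq_pexp2l //; lia.
  - apply: leq_trans (inp_le i); apply: leq_trans (class_disjoint _ (vertex_sum chosen)).
    by apply: leq_sum => j _; rewrite out_res; case: ifP => // _; rewrite size_map.
  case okj : (ok j); last by rewrite big1 // => i _; rewrite out_res okj.
  apply: leq_trans okj; rewrite -load_chosen; apply: leq_sum => i _.
  by rewrite out_res; case: ifP => // _; rewrite size_map.
apply: at_state_ext (next_at_state (t := 3) isT at_c mem_res) => j.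
rewrite /collected; case: ifP => okj.
  by congr flatten; apply: eq_map => i; rewrite out_res okj.
transitivity (flatten (map (fun _ : 'I_p => [::] : seq nat) (enum 'I_p))).
  by congr flatten; apply: eq_map => i; rewrite out_res okj.
by elim: (enum 'I_p).
Qed.

Lemma round4 c : at_state c C [::] collected ->
  legal_round W (4 + ph * 8).+1 (xs 4) c /\
  at_state (next_config (4 + ph * 8).+1 (xs 4) c) C [::]
    (fun j => flatten [seq [seq val v | v <- owned n j & v \in R i] | i : 'I_p]).
Proof.
move=> at_c.
have mem_res i : (phase_step l kap del ph 4 i (xs 4 i) (inp i) C [::] (collected i)).1
    = store (inp i) C [::] by [].
have out_res i j : (phase_step l kap del ph 4 i (xs 4 i) (inp i) C [::] (collected i)).2 j
    = [seq val v | v <- owned n j & v \in R i].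
  rewrite /= /R /collected; case: ifP => _; last by rewrite peel_empty.
  rewrite (_ : peel _ _ _ = peel (class_rel e C col i) (del ph - 2 - kap ph)
                              (layers l (kap ph) (del ph))) //.
  apply: peel_ext => u u'; rewrite (word_graph_class dist.1 e_sym e_irr).
  by rewrite /class_rel !chosen_col.
split.
  apply: (round_legal_small (t := 4) isT at_c mem_res) => // i j; rewrite out_res.
    by rewrite all_map; apply/allP => v _; exact: val_lt.
  by rewrite size_map size_filter (leq_trans (count_size _ _)) ?size_owned.
apply: at_state_ext (next_at_state (t := 4) isT at_c mem_res) => j.
by congr flatten; apply: eq_map => i; rewrite out_res.
Qed.

Let P := peeled e p (32 * n) (del ph - 2 - kap ph) (layers l (kap ph) (del ph)) C col.

Lemma round5 c :
    at_state c C [::]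
      (fun j => flatten [seq [seq val v | v <- owned n j & v \in R i] | i : 'I_p]) ->
  legal_round W (5 + ph * 8).+1 (xs 5) c /\
  at_state (next_config (5 + ph * 8).+1 (xs 5) c) C [::]
    (fun=> flatten [seq [seq val v | v <- owned n j & v \in P] | j : 'I_p]).
Proof.
set inbox := (fun _ => _) => at_c.
have mem_res i : (phase_step l kap del ph 5 i (xs 5 i) (inp i) C [::] (inbox i)).1
    = store (inp i) C [::] by [].
have out_res i j : (phase_step l kap del ph 5 i (xs 5 i) (inp i) C [::] (inbox i)).2 j
    = [seq val v | v <- owned n i & v \in P].
  rewrite /=; congr map; apply: eq_in_filter => v vi.
  apply/flatten_mapP/bigcupP => [[h _]|[h okh vR]].
    rewrite mem_map; last exact: val_inj.
    rewrite mem_filter /R; case: ifP => [okh /andP[vR _]|]; last by rewrite inE.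
    by exists h.
  exists h; first exact: mem_enum.
  rewrite mem_map; last exact: val_inj.
  by rewrite mem_filter vi /R /ok okh vR.
split.
  apply: (round_legal_small (t := 5) isT at_c mem_res) => // i j; rewrite out_res.
    by rewrite all_map; apply/allP => v _; exact: val_lt.
  by rewrite size_map size_filter (leq_trans (count_size _ _)) ?size_owned.
apply: at_state_ext (next_at_state (t := 5) isT at_c mem_res) => j.
by congr flatten; apply: eq_map => i; rewrite out_res.
Qed.

Let C1 := C :|: P.

Lemma round6 c :
    at_state c C [::]
      (fun=> flatten [seq [seq val v | v <- owned n j & v \in P] | j : 'I_p]) ->
  legal_round W (6 + ph * 8).+1 (xs 6) c /\
  at_state (next_config (6 + ph * 8).+1 (xs 6) c) C1 [::]
    (fun j => flatten [seq [seq v + n * local_degree (inp i) C1 v | v : 'I_n <- owned n j] | i : 'I_p]).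
Proof.
set inbox := (fun _ => _) => at_c.
have absorb i : C :|: mset n (inbox i) = C1.
  congr (_ :|: _); rewrite (mset_owned p_gt0 (fun _ v => v \in P)).
  by apply/setP=> v; rewrite inE.
have mem_res i : (phase_step l kap del ph 6 i (xs 6 i) (inp i) C [::] (inbox i)).1
    = store (inp i) C1 [::] by rewrite /= absorb.
have out_res i j : (phase_step l kap del ph 6 i (xs 6 i) (inp i) C [::] (inbox i)).2 j
    = [seq v + n * local_degree (inp i) C1 v | v : 'I_n <- owned n j] by rewrite /= absorb.
split.
  apply: (round_legal_small (t := 6) isT at_c mem_res) => // i j; rewrite out_res.
    rewrite all_map; apply/allP => v _; apply: vertex_word_lt.
    exact: leq_trans (count_size _ _) (inp_le i).
  by rewrite size_map size_owned.
apply: at_state_ext (next_at_state (t := 6) isT at_c mem_res) => j.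
by congr flatten; apply: eq_map => i; rewrite out_res.
Qed.

(** Local degrees add up to exact residual degrees at the owner, who announces the trimmed vertices
    to all. *)
Lemma round7 c :
    at_state c C1 [::]
      (fun j => flatten [seq [seq v + n * local_degree (inp i) C1 v | v : 'I_n <- owned n j] | i : 'I_p]) ->
  legal_round W (7 + ph * 8).+1 (xs 7) c /\
  at_boundary (next_config (7 + ph * 8).+1 (xs 7) c)
    (phase l e p (kap ph) (del ph) col C).
Proof.
set inbox := (fun _ => _) => at_c.
have mem_res i : (phase_step l kap del ph 7 i (xs 7 i) (inp i) C1 [::] (inbox i)).1
    = store (inp i) C1 [::] by [].
have out_res i j : (phase_step l kap del ph 7 i (xs 7 i) (inp i) C1 [::] (inbox i)).2 j
    = [seq val v | v <- owned n i & 2 ^ del ph.+1 <= #|nbrs (residual e C1) v|].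
  rewrite /=; congr map; apply: eq_in_filter => v; rewrite (mem_owned p_gt0) => /eqP vi.
  rewrite /inbox vertex_sum_flatten -(sum_local_degree dist.1 e_sym e_irr).
  by congr (_ <= _); apply: eq_bigr => h _; rewrite (vertex_sum_owned p_gt0) vi eqxx.
split.
  apply: (round_legal_small (t := 7) isT at_c mem_res) => // i j; rewrite out_res.
    by rewrite all_map; apply/allP => v _; exact: val_lt.
  by rewrite size_map size_filter (leq_trans (count_size _ _)) ?size_owned.
exists C1; eexists; split; first exact: (next_at_state (t := 7) isT at_c mem_res).
move=> j; rewrite /phase /trim -del_next; congr (_ :|: _).
rewrite -(mset_owned p_gt0 (fun _ v => 2 ^ del ph.+1 <= #|nbrs (residual e C1) v|)).
by congr mset; congr flatten; apply: eq_map => i; rewrite out_res.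
Qed.

End Phase.

Definition colouring (ph : nat) (x : round_coins A) : {ffun 'I_n -> 'I_(2 ^ kap ph)} :=
  chosen_colours (owner p_gt0) (expn_gt0 2 (kap ph)) x.

(** Centralised counterpart of a round. Only the coins of the first round of a phase matter, which
    is round 8 ph + 1 since round 0 repacks the input; the effect of the whole phase is booked
    there. *)
Definition sim_step (r : nat) (x : round_coins A) (C : {set 'I_n}) : {set 'I_n} :=
  if r %% 8 == 1 then
    phase l e p (kap (r %/ 8)) (del (r %/ 8)) (vals (colouring (r %/ 8) x)) C
  else C.

Lemma sim_step_phase ph x C :
  sim_step (ph * 8).+1 x C = phase l e p (kap ph) (del ph) (vals (colouring ph x)) C.
Proof. by rewrite /sim_step -addn1 modnMDl divnMDl // divn_small // addn0. Qed.

Lemma sim_step_id t ph x C : 0 < t < 8 -> sim_step (t + ph * 8).+1 x C = C.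
Proof.
move=> t8; rewrite /sim_step -addSn addnC modnMDl.
by case: t t8 => [|[|[|[|[|[|[|[|t]]]]]]]].
Qed.

Lemma run_phases N ph (xs : seq (round_coins A)) (c : mpc_config A) C :
    size xs = N * 8 -> at_boundary c C ->
  legal_from W (ph * 8).+1 xs c /\
  at_boundary (run_from (ph * 8).+1 xs c) (iterate sim_step (ph * 8).+1 xs C).
Proof.
elim: N ph xs c C => [|N IHN] ph xs c C.
  by move=> /eqP; rewrite mul0n size_eq0 => /eqP->.
case: xs => [//|x0 [//|x1 [//|x2 [//|x3 [//|x4 [//|x5 [//|x6 [//|x7 xs]]]]]]]].
move=> [] size_xs bc; set y := nth x0 [:: x0; x1; x2; x3; x4; x5; x6; x7].
have [l0 s1] := round0 ph y bc.
have [l1 s2] := round1 (xs := y) s1.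
have [l2 s3] := round2 (xs := y) s2.
have [l3 s4] := round3 (xs := y) s3.
have [l4 s5] := round4 (xs := y) s4.
have [l5 s6] := round5 (xs := y) s5.
have [l6 s7] := round6 (xs := y) s6.
have [l7 b8] := round7 (xs := y) s7.
have [lr br] := IHN ph.+1 xs _ _ size_xs b8.
split.
  exact: (conj l0 (conj l1 (conj l2 (conj l3 (conj l4 (conj l5 (conj l6 (conj l7 lr)))))))).
have phE : phase l e p (kap ph) (del ph) (vals (colouring ph x0)) C =
    phase l e p (kap ph) (del ph) (fun v => y 0 (owner p_gt0 v) v %% 2 ^ kap ph) C.
  by apply: phase_ext => v; rewrite /vals /colouring /chosen_colours ffunE.
rewrite -[iterate _ _ _ _]/(iterate sim_step (ph.+1 * 8).+1 xs
  (sim_step (7 + ph * 8).+1 x7 (sim_step (6 + ph * 8).+1 x6 (sim_step (5 + ph * 8).+1 x5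
  (sim_step (4 + ph * 8).+1 x4 (sim_step (3 + ph * 8).+1 x3 (sim_step (2 + ph * 8).+1 x2
  (sim_step (1 + ph * 8).+1 x1 (sim_step (ph * 8).+1 x0 C))))))))).
by rewrite !sim_step_id // sim_step_phase phE.
Qed.

Lemma init_boundary x : legal_round W 0 x (mpc_init inp) /\
  at_boundary (next_config 0 x (mpc_init inp)) set0.
Proof.
have mem i : (act 0 x (mpc_init inp) i).1 = store (inp i) set0 [::].
  by rewrite /act /= pair_up_edges /store enum_set0 /= !cats0.
have gather0 (q : nat) : flatten [seq [::] : seq nat | j <- enum 'I_q] = [::].
  by elim: (enum _).
split; last first.
  exists set0, (fun=> [::]); split=> i; last by rewrite set0U; apply/setP=> v; rewrite !inE.
  by split; [exact: mem | rewrite /gather /= gather0].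
move=> i; have size0 : received 0 x (mpc_init inp) i = 0 by rewrite /received big1.
rewrite size0 mem; split=> //.
- by rewrite /sent big1.
- rewrite addn0; apply: leq_trans (size_store _ _ _) _.
  by have := dist.2 i; rewrite /A /=; lia.
- by apply: store_words_lt => //; apply: leq_trans (_ : n ^ 2 * n ^ 2 <= _);
    [rewrite leq_mul2r; apply/orP; right; rewrite -mulnn; nia | rewrite -expnD].
Qed.

Lemma run_output (w : mpc_randomness A) :
  mpc_legal W inp /\ mpc_result inp w = iterate sim_step 0 w set0.
Proof.
have run (v : mpc_randomness A) : legal_from W 0 v (mpc_init inp) /\
    at_boundary (run_from 0 v (mpc_init inp)) (iterate sim_step 0 v set0).
  case: v => -[//|x xs] /= /eqP[] size_xs.
  have [l0 b0] := init_boundary x; have sz : size xs = phases * 8 by rewrite size_xs mulnC.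
  by have [lr br] := run_phases 0 sz b0.
have out v i : machine_output inp v i = iterate sim_step 0 v set0.
  have [_ [C0 [inbox [at_c absorb]]]] := run v; rewrite /machine_output -(absorb i).
  by have [mem_i inbox_i] := at_c i; rewrite /= /output mem_i inbox_i store_setK.
split=> [v|].
  split=> [|i]; first exact: (run v).1.
  by rewrite out (leq_trans (max_card _)) // card_ord /A /=; lia.
rewrite /mpc_result; apply/eqP; rewrite eqEsubset; apply/andP; split.
  by apply/bigcupsP => i _; rewrite out.
by apply: (@bigcup_max _ _ (Ordinal p_gt0)) => //; rewrite out.
Qed.

End Run.

(** * Schedule and conclusion *)

Lemma vertex_coverP n (e : rel 'I_n) (C : {set 'I_n}) :
  reflect (forall u v, e u v -> (u \in C) || (v \in C)) (vertex_cover e C).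
Proof.
apply: (iffP forallP) => [h u v euv|h u]; last by apply/forallP => v; apply/implyP/h.
by have /forallP/(_ v)/implyP := h u; apply.
Qed.

Definition min_cover n (e : rel 'I_n) : {set 'I_n} :=
  [arg min_(C < setT | vertex_cover e C) #|C|].

Lemma min_coverP n (e : rel 'I_n) :
  vertex_cover e (min_cover e) /\ forall C, vertex_cover e C -> #|min_cover e| <= #|C|.
Proof.
rewrite /min_cover; case: arg_minnP => [|O]; last by [].
by apply/vertex_coverP => u v _; rewrite inE.
Qed.

Section Schedule.

Variables (n m : nat).

(** Chosen so that 2^slack >= 16 (log n + 1), as the tail bounds require. *)
Definition slack : nat := log (log n) + 5.

(* Phase ph uses 2 ^ kap ph colours; when it starts, all residual degrees are
   below 2 ^ del ph. *)
Definition bits (ph delta : nat) : nat :=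
  if ph is 0 then (log (m %/ n)).+1 else uphalf delta.

Fixpoint del (ph : nat) : nat :=
  if ph is ph'.+1 then next_delta slack (bits ph' (del ph')) (del ph') else (log n).+1.

Definition kap (ph : nat) : nat := bits ph (del ph).

Lemma kapS ph : kap ph.+1 = uphalf (del ph.+1).
Proof. by []. Qed.

(** After [log (log n) + 2] phases the degree exponent is at most [2 * slack + 6], and each further
    phase lowers it by at least one until it is 0. *)
Definition phases : nat := 3 * log (log n) + 18.

Lemma next_delta_le l kappa delta : next_delta l kappa delta <= delta.
Proof. by rewrite /next_delta; case: ifP => _; lia. Qed.

Lemma del_le ph : del ph <= (log n).+1.
Proof. by elim: ph => //= ph; apply: leq_trans; exact: next_delta_le. Qed.

Lemma del_antimono ph : del ph.+1 <= del 1.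
Proof. by elim: ph => // ph; apply: leq_trans; exact: next_delta_le. Qed.

Lemma del1_le : del 1 <= (log (m %/ n)).+1 + slack + 2.
Proof. by rewrite /= /next_delta /layers; case: ifP; lia. Qed.

(** Ensures that the machines provided for the first phase suffice later. If a later phase samples,
    half its exponent exceeds [slack + 2], while the exponent is at most [del 1], bounded by
    [del1_le]. *)
Lemma kap_later ph : 0 < layers slack (kap ph.+1) (del ph.+1) ->
  kap ph.+1 <= (log (m %/ n)).+1.
Proof.
have := del1_le; have := del_antimono ph.
rewrite kapS /layers /slack; move: (del _) (del 1) => d d1; lia.
Qed.

Lemma slack_large : 16 * (log n).+1 <= 2 ^ slack.
Proof.
have : (log n).+1 <= 2 ^ (log (log n)).+1 by rewrite trunc_log_ltn.
by rewrite /slack -addSnnS expnD; move: (2 ^ _) => a; lia.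
Qed.

(** Sampling takes [d] to about d/2 + slack, so the excess over [2 * slack + 5], the largest
    exponent without sampling, is halved. *)
Lemma next_delta_halve (t d : nat) : d <= 2 * slack + 5 + 2 ^ t.+1 ->
  next_delta slack (uphalf d) d <= 2 * slack + 5 + 2 ^ t.
Proof.
rewrite /next_delta /layers expnS; have : 0 < 2 ^ t by rewrite expn_gt0.
by move: (2 ^ t) => a; case: ifP; rewrite /slack; lia.
Qed.

Lemma next_delta_pred (d : nat) : d <= 2 * slack + 6 ->
  next_delta slack (uphalf d) d <= d.-1.
Proof. by rewrite /next_delta /layers; case: ifP; lia. Qed.

Lemma del_phases : del phases = 0.
Proof.
(* The first phase is credited with no progress; halving starts from log n + 1 <= 2^(log log n +
   1). *)
have halving t : t <= log (log n) -> del t.+1 <= 2 * slack + 5 + 2 ^ ((log (log n)).+1 - t).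
  elim: t => [|t IHt] tl.
    rewrite subn0; apply: leq_trans (next_delta_le _ _ _) _.
    have : (log n).+1 <= 2 ^ (log (log n)).+1 by rewrite trunc_log_ltn.
    by rewrite /=; move: (2 ^ _) => a; lia.
  rewrite [del _]/(next_delta slack (uphalf (del t.+1)) (del t.+1)) subSS.
  by apply: next_delta_halve; rewrite -subSn ?(ltnW tl) //; exact: IHt (ltnW tl).
have start : del (log (log n)).+2 <= 2 * slack + 6.
  rewrite [del _]/(next_delta slack (uphalf (del (log (log n)).+1)) (del (log (log n)).+1)).
  rewrite (_ : 2 * slack + 6 = 2 * slack + 5 + 2 ^ 0); last by rewrite expn0; lia.
  by apply: next_delta_halve; have := halving _ (leqnn _); rewrite subSnn.
have descent t : del (t + (log (log n)).+2) <= 2 * slack + 6 - t.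
  elim: t => [|t IHt]; first by rewrite subn0.
  rewrite addSn addnS; set t' := (t + _).+1.
  rewrite [del _]/(next_delta slack (uphalf (del t')) (del t')) /t'.
  rewrite -addnS; apply: leq_trans (next_delta_pred _) _; lia.
have := descent (2 * slack + 6); rewrite subnn leqn0 => /eqP <-.
by congr del; rewrite /phases /slack; lia.
Qed.

End Schedule.

(** * Graphs with at least as many edges as vertices *)

Section Main.

Variables (n m : nat).
Hypotheses (n_large : 1024 <= n) (m_large : n <= m).

(** Provides one machine per colour of the first phase, with O(m) memory in total. *)
Definition machines : nat := (m %/ n).*2.+2.

Definition main_algorithm : mpc_algorithm n :=
  peeling_algorithm n machines (slack n) (kap n m) (del n m) (128 * n) (phases n).
Let A := main_algorithm.

Variables (e : rel 'I_n) (inp : mpc_input A).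
Hypotheses (e_simple : simple_graph e) (e_card : #|edges e| = m).
Hypothesis dist : distributes e inp.

Lemma n_gt0 : 0 < n. Proof. by apply: leq_trans n_large. Qed.

Lemma m_le : m <= n * n.
Proof. by rewrite -e_card (leq_trans (max_card _)) // card_prod card_ord. Qed.

Lemma ratio_le : m %/ n <= n.
Proof. by have := leq_div2r n m_le; rewrite mulnK ?n_gt0. Qed.

Lemma machines_le : machines <= 4 * n.
Proof. by have := ratio_le; rewrite /machines; move: (m %/ n) => a; lia. Qed.

Lemma kap_le ph : kap n m ph <= (log n).+1.
Proof.
case: ph => [|ph]; first by rewrite /kap /= ltnS leq_trunc_log // ratio_le.
have := del_le n m ph.+1; rewrite kapS.
by move: (del _ _ _) (log n) => d a; lia.
Qed.

Lemma first_colours_le : 2 ^ kap n m 0 <= machines.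
Proof.
have a0 : 0 < m %/ n by rewrite divn_gt0 ?n_gt0.
have /andP[h _] := log_bounds a0; rewrite /kap /= expnS /machines.
by move: (m %/ n) (2 ^ _) h => a b; lia.
Qed.

Lemma edges_le_first : #|edges e| <= n * 2 ^ kap n m 0.
Proof.
have a0 : 0 < m %/ n by rewrite divn_gt0 ?n_gt0.
have /andP[_ h] := log_bounds a0; rewrite e_card /kap /=.
by rewrite -(leq_pmul2l n_gt0) in h; have := ltn_ceil m n_gt0; lia.
Qed.

Lemma colours_le ph : 0 < layers (slack n) (kap n m ph) (del n m ph) -> 2 ^ kap n m ph <= machines.
Proof.
case: ph => [|ph]; first by move=> _; exact: first_colours_le.
by move=> /kap_later h; apply: leq_trans first_colours_le; rewrite leq_exp2l.
Qed.

Definition opt : {set 'I_n} := min_cover e.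

Lemma optP u v : e u v -> (u \in opt) || (v \in opt).
Proof. exact: (vertex_coverP _ _ (min_coverP e).1). Qed.

Let fail ph (C : {set 'I_n}) (x : round_coins A) : bool :=
  ~~ phase_ok (slack n) e opt machines (kap n m ph) (del n m ph)
      (vals (colouring (isT : 0 < machines) ph x)) C.

(** The failure bounds for uniform colourings are carried over to the coins by [card_chosen]. *)
Lemma fail_card ph C : degree_lt e C (2 ^ del n m ph) ->
  #|[set x | fail ph C x]| * (if ph is 0 then 2 * n else n ^ 2) <= #|round_coins A|.
Proof.
move=> deg; set a := (if ph is 0 then _ else _).
have [e_sym e_irr] := e_simple.
have large := slack_large n.
have n1 : 1 < n by apply: leq_trans n_large.
have n2 : 2 < n by apply: leq_trans n_large.
have k0 : 0 < (2 ^ kap n m ph) ^ n by rewrite !expn_gt0.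
pose bad (chi : {ffun 'I_n -> 'I_(2 ^ kap n m ph)}) :=
  ~~ phase_ok (slack n) e opt machines (kap n m ph) (del n m ph) (vals chi) C.
have bad_card : #|[set chi | bad chi]| * a <= (2 ^ kap n m ph) ^ n.
  rewrite /a /bad; case: ph {a k0 bad} deg => [|ph] deg.
    case: (posnP (layers (slack n) (kap n m 0) (del n m 0))) => [L0|L0].
      rewrite eq_card0 // => chi; rewrite !inE; apply/negbTE; rewrite negbK.
      by apply: phase_ok_plain; rewrite ?kap_le ?del_le //; exact: optP.
    exact: (phase_fail_first n1 large e_sym optP deg (kap_le 0) (del_le n m 0) n2 L0
      first_colours_le edges_le_first).
  apply: (phase_fail_later n1 large e_sym optP deg (kap_le _) (del_le n m _) n2).
    exact: colours_le.
  by rewrite kapS; move: (del _ _ _) => d; lia.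
have dvd : 2 ^ kap n m ph %| 2 ^ colour_bits n by rewrite dvdn_exp2l ?kap_le.
have := card_chosen (owner (isT : 0 < machines)) (expn_gt0 2 (kap n m ph)) dvd bad.
rewrite card_ord => fibre; rewrite -(leq_pmul2r k0) mulnAC.
rewrite [X in X * a <= _](_ : _ = #|[set chi | bad chi]| * #|round_coins A|); last exact: fibre.
by rewrite mulnAC [leqRHS]mulnC leq_mul2r bad_card orbT.
Qed.

(** Phases that [sim_step] has completed before round [r]; the offset makes the count rise just
    after round 8 ph + 1. *)
Definition rounds_done (r : nat) : nat := (r + 6) %/ 8.

Definition on_track (r : nat) (C : {set 'I_n}) : bool :=
  degree_lt e C (2 ^ del n m (rounds_done r)) &&
  (#|C :\: opt| + 32 * del n m (rounds_done r) * #|opt| <= 32 * (log n).+1 * #|opt|).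

Let next (r : nat) (x : round_coins A) C : {set 'I_n} :=
  sim_step e (isT : 0 < machines) r x C.

Lemma on_track0 : on_track 0 set0.
Proof.
rewrite /on_track /rounds_done divn_small // set0D cards0 leqnn andbT.
apply/forallP => v; have /andP[_ h] := log_bounds n_gt0; apply: leq_ltn_trans h.
by rewrite -[leqRHS]card_ord max_card.
Qed.

Lemma main_run w :
  mpc_legal (n ^ 4) inp /\ mpc_result inp w = iterate next 0 w set0.
Proof.
have [e_sym e_irr] := e_simple; have n100 : 100 <= n by apply: leq_trans n_large.
exact: (run_output e_sym e_irr dist n100 isT machines_le (fun=> erefl) w).
Qed.

Lemma step_fail_card r C : on_track r C ->
  #|[set x | ~~ on_track r.+1 (next r x C)]| * (if r == 1 then 2 * n else n ^ 2)
    <= #|round_coins A|.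
Proof.
move=> track; case: (eqVneq (r %% 8) 1) => [r1|r1]; last first.
  rewrite eq_card0 // => x; rewrite !inE /next /sim_step (negbTE r1).
  suff done : rounds_done r.+1 = rounds_done r.
    by apply/negbTE; rewrite negbK /on_track done.
  by rewrite /rounds_done; move: r1; clear; lia.
have [ph rE] : exists ph, r = (ph * 8).+1.
  by exists (r %/ 8); rewrite {1}(divn_eq r 8) r1 addn1.
subst r; move: track; rewrite /on_track.
have -> : rounds_done (ph * 8).+1 = ph by rewrite /rounds_done; clear; lia.
have -> : rounds_done (ph * 8).+2 = ph.+1 by rewrite /rounds_done; clear; lia.
case/andP=> deg charge; have := fail_card deg.
rewrite (_ : (_ == 1) = (ph == 0)); last by clear; lia.
case: ph {r1} deg charge => [|ph] deg charge /=; apply: leq_trans;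
  rewrite leq_mul2r; apply/orP; right; apply/subset_leq_card/subsetP => x;
  rewrite !inE; apply: contraNN => /andP[d c];
  rewrite /next sim_step_phase d /=; exact: leq_trans c charge.
Qed.

(** Finally all residual degrees are below 1, so [C] is a cover. It has at most |opt| vertices in
    [opt] and 32 (log n + 1) |opt| others, and 33 + 32 log n <= 65 log n. *)
Lemma on_track_approx C : on_track (mpc_rounds A) C ->
  approx_vertex_cover e (65 * log n) C.
Proof.
rewrite /on_track /rounds_done /A /= (_ : _ %/ 8 = phases n); last first.
  by move: (phases n); clear; lia.
rewrite del_phases muln0 addn0 => /andP[/forallP deg charge]; apply/andP; split.
  apply/vertex_coverP => u v euv; have := deg u; rewrite expn0 ltnS leqn0 cards_eq0.
  apply: contraTT; rewrite negb_or => /andP[uC vC]; apply/set0Pn; exists v.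
  by rewrite inE /residual euv uC vC.
rewrite -/opt -(cardsID opt C).
have cap : #|C :&: opt| <= #|opt| by apply/subset_leq_card/subsetIr.
have lg : 0 < log n by rewrite trunc_log_gt0 /=; apply: leq_trans n_large.
apply: leq_trans (leq_add cap charge) _; rewrite -[X in X + _]mul1n -mulnDl.
by rewrite leq_mul2r; apply/orP; right; lia.
Qed.

Import GRing.Theory Num.Theory Order.TTheory.
Local Open Scope ring_scope.

Let eps (r : nat) : rat := (if r == 1%N then 2 * n else n ^ 2)%N%:R^-1.

Lemma eps_ge0 r : 0 <= eps r.
Proof. by rewrite /eps invr_ge0 ler0n. Qed.

Lemma step_fail_prob r C : on_track r C ->
  #|[set x | ~~ on_track r.+1 (next r x C)]|%:R <= eps r * #|round_coins A|%:R.
Proof.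
move=> /step_fail_card; rewrite /eps; set a := (if _ then _ else _)%N => h.
have a0 : (0 < a)%N by rewrite /a; case: ifP => _; rewrite ?muln_gt0 ?expn_gt0 n_gt0.
by rewrite mulrC ler_pdivlMr ?ltr0n // -natrM ler_nat.
Qed.

Lemma log_small : (2 * (8 * phases n).+1 <= n)%N.
Proof.
have /andP[lo _] := log_bounds n_gt0.
have lg : (10 <= log n)%N by apply: trunc_log_max => //; apply: leq_trans n_large.
have lglg : (log (log n) <= log n)%N.
  apply: leq_trans (_ : (2 ^ log (log n) <= _)%N); first exact/ltnW/ltn_expl.
  by have /andP[] := log_bounds (leq_trans (isT : 0 < 10)%N lg).
(* Twice the number of rounds is 48 log log n + 290, compared here with 2^(log n) for log n >=
   10. *)
have grow t : (48 * (t + 10) + 290 <= 2 ^ (t + 10))%N.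
  by elim: t => // t IHt; rewrite addSn expnS; lia.
apply: leq_trans lo; rewrite -(subnK lg); apply: leq_trans (grow _).
by rewrite subnK // /phases; lia.
Qed.

(** The first phase contributes 1/(2n), and all rounds at n^(-2) each at most another 1/(2n) by
    [log_small]. *)
Lemma total_eps : \sum_(i < mpc_rounds A) eps (0 + i) <= n%:R^-1.
Proof.
have n0 : (0 < n%:R :> rat) by rewrite ltr0n n_gt0.
apply: le_trans (_ : \sum_(i < mpc_rounds A)
    ((i == 1%N :> nat)%:R * (2 * n%:R)^-1 + (n%:R ^+ 2)^-1) <= _).
  apply: ler_sum => i _; rewrite add0n /eps; case: eqP => _.
    by rewrite mul1r natrM lerDl invr_ge0 exprn_ge0 // ltW.
  by rewrite mul0r add0r natrX.
rewrite big_split /= -mulr_suml sumr_const card_ord.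
have one : \sum_(i < (8 * phases n).+1) ((i == 1%N :> nat)%:R : rat) = 1.
  have h : (1 < (8 * phases n).+1)%N by rewrite /phases; lia.
  rewrite (bigD1 (Ordinal h)) //= big1 ?addr0 // => i.
  by rewrite -val_eqE /= => /negbTE ->.
rewrite one mul1r -[_ *+ (8 * _).+1]mulr_natr.
have := log_small; rewrite -(ler_nat rat) natrM => small.
rewrite -(ler_pM2r n0) mulVf ?gt_eqF // mulrDl.
have -> : (2 * n%:R)^-1 * n%:R = 2^-1 :> rat by rewrite invfM -mulrA mulVf ?gt_eqF // mulr1.
have -> : (n%:R ^+ 2)^-1 * (8 * phases n).+1%:R * n%:R = (8 * phases n).+1%:R / n%:R :> rat.
  by rewrite expr2 invfM [LHS]mulrAC -[_^-1 * _^-1 * _]mulrA mulVf ?gt_eqF // mulr1 mulrC.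
have : (8 * phases n).+1%:R / n%:R <= 2^-1 :> rat.
  by rewrite ler_pdivrMr // mulrC ler_pdivlMr // mulrC.
move=> h; apply: le_trans (lerD (lexx _) h) _.
by rewrite -[2^-1]mul1r -mulrDl -[1 + 1]/(2%:R) mulfV.
Qed.

Lemma main_prob :
  1 - n%:R^-1 <= mpc_prob inp (approx_vertex_cover e (65 * log n)).
Proof.
have out w : mpc_result inp w = iterate next 0 w set0.
  exact: (main_run w).2.
have chain := chain_fail eps_ge0 step_fail_prob (mpc_rounds A) on_track0.
rewrite /mpc_prob; set N : rat := #|mpc_randomness A|%:R.
have NE : N = #|round_coins A|%:R ^+ mpc_rounds A by rewrite /N card_tuple natrX.
have N0 : 0 < N.
  by rewrite NE exprn_gt0 // ltr0n card_ffun expn_gt0 coins_inhabited.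
rewrite ler_pdivlMr // mulrBl mul1r lerBlDr.
pose bad := [set w : mpc_randomness A | ~~ on_track (mpc_rounds A) (iterate next 0 w set0)].
apply: le_trans (_ : #|~: bad|%:R + #|bad|%:R <= _).
  by rewrite -natrD addnC cardsC.
apply: lerD.
  rewrite ler_nat; apply/subset_leq_card/subsetP => w; rewrite !inE negbK out.
  exact: on_track_approx.
apply: le_trans chain _; rewrite NE ler_wpM2r ?exprn_ge0 ?ler0n //; exact: total_eps.
Qed.

End Main.

(** * Graphs with fewer edges than vertices, solved by one machine *)

Section Small.

Variables n m : nat.

Definition local_cover (mem : seq nat) : {set 'I_n} :=
  min_cover (word_graph (pair_up n mem)).

Lemma unit_inhabited : 0 < #|{: unit}|.
Proof. by rewrite card_unit. Qed.

Definition local_algorithm : mpc_algorithm n :=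
  @MPCAlgorithm n 1 (2 * m) 0 unit unit_inhabited
    (fun _ _ _ mem _ => (mem, fun=> [::])) (fun _ mem _ => local_cover mem).
Let A := local_algorithm.

Variables (e : rel 'I_n) (inp : mpc_input A).
Hypotheses (e_simple : simple_graph e) (e_card : #|edges e| = m).
Hypothesis dist : distributes e inp.

Lemma local_graph :
  word_graph (pair_up n (flatten [seq [:: val uv.1; val uv.2] | uv <- inp ord0])) =2 e.
Proof.
have [e_sym e_irr] := e_simple.
have memE uv : (uv \in inp ord0) = (uv.1 < uv.2) && e uv.1 uv.2.
  have := perm_mem dist.1 uv; rewrite mem_enum inE => <-.
  apply/idP/flatten_mapP => [h|[i _]]; first by exists ord0; rewrite ?mem_enum.
  by rewrite (ord1 i).
move=> u v; rewrite /word_graph pair_up_edges !mem_map; try exact: edge_word_inj.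
rewrite !memE /= [e v u]e_sym; case: ltngtP => //= [|uv]; first by rewrite orbF.
by rewrite (val_inj uv) e_irr.
Qed.

(** Shows that a minimum cover fits in the memory: the smaller endpoints of the edges form a
    cover. *)
Lemma small_cover : exists2 C, vertex_cover e C & #|C| <= m.
Proof.
exists [set uv.1 | uv in edges e]; last by rewrite -e_card leq_imset_card.
have [e_sym e_irr] := e_simple; apply/vertex_coverP => u v euv; apply/orP.
case: (ltngtP u v) => uv; last by rewrite (val_inj uv) e_irr in euv.
  by left; apply/imsetP; exists (u, v); rewrite // inE uv euv.
by right; apply/imsetP; exists (v, u); rewrite // inE uv e_sym.
Qed.

Lemma local_outputP w i : vertex_cover e (machine_output inp w i) /\
  forall C, vertex_cover e C -> #|machine_output inp w i| <= #|C|.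
Proof.
pose g : rel 'I_n := word_graph (pair_up n (flatten [seq [:: val uv.1; val uv.2] | uv <- inp ord0])).
have coverE C : vertex_cover g C = vertex_cover e C.
  by apply: eq_forallb => u; apply: eq_forallb => v; rewrite /g local_graph.
have -> : machine_output inp w i = min_cover g.
  have w0 : tval w = [::] by rewrite tuple0.
  by rewrite /machine_output w0 /= (ord1 i).
have [cov min] := min_coverP g; split; first by rewrite -coverE.
by move=> C hC; apply: min; rewrite coverE.
Qed.

Lemma local_legal W : mpc_legal W inp.
Proof.
move=> w; split=> [|i]; first by rewrite tuple0.
have [C covC Cm] := small_cover.
apply: leq_trans ((local_outputP w i).2 C covC) _.
by rewrite /A /= (leq_trans Cm) // leq_pmull.
Qed.

Lemma local_correct a w : 0 < a -> approx_vertex_cover e a (mpc_result inp w).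
Proof.
move=> a0; rewrite /mpc_result big_ord1; have [cov opt] := local_outputP w ord0.
rewrite /approx_vertex_cover cov /=; apply: leq_trans (leq_pmull _ a0).
exact: opt (min_coverP e).1.
Qed.

End Small.

(* The constants of the asymptotic bounds: words are numbers below n ^ w, that
   is, have O(log n) bits; 2 * m words are needed to represent m edges; the
   success probability is at least 1 - 1 / n ^ k. *)
Theorem theorem1 :
  exists A : forall n m : nat, mpc_algorithm n,
  exists w cmem ctotal crounds capprox k n0 : nat,
    0 < k /\
    forall n m : nat, n0 <= n ->
      0 < mpc_machines (A n m) /\
      mpc_memory (A n m) <= cmem * n /\
      m <= mpc_machines (A n m) * (mpc_memory (A n m))./2 /\
      mpc_machines (A n m) * mpc_memory (A n m) <= ctotal * (2 * m) /\
      mpc_rounds (A n m) <= crounds * log (log n) /\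
      forall (e : rel 'I_n) (inp : mpc_input (A n m)),
        simple_graph e -> #|edges e| = m -> distributes e inp ->
        mpc_legal (n ^ w) inp /\
        (1 - (n%:R ^+ k)^-1 <=
           mpc_prob inp (approx_vertex_cover e (capprox * log n)))%R.
Proof.
(* For few edges, machines with memory of order n would exceed a total of O(m). *)
exists (fun n m => if m < n then local_algorithm n m else main_algorithm n m).
(* For n <= m the total memory 128n (2 (m/n) + 2) is at most 512m. The number of rounds is 24 log
   log n + 145, at most 169 log log n. *)
exists 4, 128, 256, 169, 65, 1, 1024; split=> // n m n_large.
have lg : 0 < log n by rewrite trunc_log_gt0 /=; apply: leq_trans n_large.
case: (ltnP m n) => [small|large].
  split=> //; split; first by rewrite /=; lia.
  split; first by rewrite /=; lia.
  split; first by rewrite /=; lia.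
  split=> // e inp simple card dist; split.
    exact: (local_legal simple card dist).
  rewrite /mpc_prob (_ : [set w | _] = setT); last first.
    by apply/setP=> w; rewrite !inE (local_correct simple dist) ?muln_gt0.
  rewrite cardsT card_tuple expn0 GRing.divr1.
  by rewrite Num.Theory.lerBlDr Num.Theory.lerDl GRing.expr1 Num.Theory.invr_ge0 Num.Theory.ler0n.
have lglg : 0 < log (log n).
  by rewrite trunc_log_gt0 /=; apply: trunc_log_max => //; apply: leq_trans n_large.
have mod := ltn_pmod m (n_gt0 n_large).
have mE := divn_eq m n.
split=> //; split; first by [].
split.
  rewrite /= (_ : (128 * n)./2 = 64 * n); last by lia.
  by rewrite /machines; move: (m %/ n) (m %% n) mod mE => a b; nia.
split.
  by rewrite /= /machines; move: (m %/ n) (m %% n) mod mE => a b; lia.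
split; first by rewrite /= /phases; move: (log (log n)) lglg => a; lia.
move=> e inp simple card dist; split.
  by move=> w; exact: (main_run n_large large simple card dist w).1 w.
rewrite GRing.expr1; exact: (main_prob n_large large simple card dist).
Qed.
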